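(* Let $$f(x_1,x_2)=\alpha(x_1-x_2)^2+\beta(x_1+x_2-2p)^2 .$$ If $\alpha<0$ or $2\beta>\alpha$, then the following identity holds: $$\max_{\mu\in\mathcal{C}_p}\int f(x_1,x_2)\,d\mu=\max(0,4\beta,\alpha+\beta)\cdot p(1-p).$$ Otherwise, if $\alpha\ge\max(0,2\beta)$, then the following bound holds: $$\max_{\mu\in\mathcal{C}_p}\int f(x_1,x_2)\,d\mu\le p(1-p)\,\frac{\alpha^2}{\alpha-\beta}.$$ Moreover, in this case (that is, $\alpha\ge\max(0,2\beta)$), the equality is achieved if and only if there exists $N\in\mathbb{N}$ such that at least one of the following three conditions is satisfied: 1. $\frac{\alpha-\beta}{\alpha}=N$ and $\left(2-\frac{\alpha}{\alpha-\beta}\right)p+\frac{\alpha}{\alpha-\beta}\ge 1\ge\left(2-\frac{\alpha}{\alpha-\beta}\right)p$; 2. $\frac{2(\alpha-\beta)-(\alpha-2\beta)p}{\alpha}=N$ and $\left(2-\frac{\alpha}{\alpha-\beta}\right)p+\frac{\alpha}{\alpha-\beta}>1$; 3. $\frac{2(\alpha-\beta)-(\alpha-2\beta)(1-p)}{\alpha}=N$ and $\left(2-\frac{\alpha}{\alpha-\beta}\right)p<1$. In the case of equality, the optimum is attained at a ladder distribution with $2N-1$ points in the support if condition 1 does not hold, and at a convex combination of two such distributions if condition 1 does hold.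
   Context: Here $\alpha,\beta$ are real numbers and $p$ is the success probability of a Bernoulli random variable. A probability distribution $\mu$ on $[0,1]^2$ is called coherent if there exist a probability space $(\Omega,\mathcal{F},\mathbb{P})$, a Bernoulli (i.e. $\{0,1\}$-valued) random variable $X$ on it, and two sub-sigma-algebras $\mathcal{F}_1,\mathcal{F}_2\subset\mathcal{F}$ such that $\mu$ is the joint distribution of $(X_1,X_2)$, where $X_i=\mathbb{E}[X\mid\mathcal{F}_i]$. $\mathcal{C}_p$ denotes the set of coherent distributions arising with $\mathbb{E}[X]=p$. A distribution $\mu$ is called a ladder distribution if its support can be represented as a sequence of points $((x_i,y_i))_{i=1}^n$ such that: (i) all points $(x_i,y_i)$ are distinct; (ii) the sequences $(x_i)_{i=1}^n$ and $(y_i)_{i=1}^n$ are monotone (weakly increasing or decreasing); (iii) $x_i=x_{i+1}$ or $y_i=y_{i+1}$ for all $i\in\{1,\dots,n-1\}$; (iv) there are at most two points on any horizontal or vertical line.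
   Formalization: The equality criterion and the form of the optimum are stated for α>0 (at α=0 the conditions divide by 0). For α=2β>0, 0<p<1, where the only optimum has the two points (0,0),(1,1) though N=1, a convex combination of two (2N−1)-point ladders is claimed instead of one ladder. *)

(* Defs.v *)
From HB Require Import structures.
From mathcomp Require Import all_boot all_order all_algebra.
From mathcomp Require Import all_classical all_reals all_analysis.

Set Implicit Arguments.
Unset Strict Implicit.
Unset Printing Implicit Defensive.

Import Order.TTheory GRing.Theory Num.Theory.
Import numFieldNormedType.Exports.

Local Open Scope classical_set_scope.
Local Open Scope ring_scope.

(* Borel probability measures on the plane; those living on [0,1]^2 are singled out
   by [on_unit_square]. *)
Notation plane_prob R := (probability (prod R R) R).

Definition on_unit_square (R : realType) (mu : plane_prob R) : Prop :=
  mu (`[0, 1] `*` `[0, 1]) = 1%E.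

Definition sub_sigma_algebra (d : measure_display) (Omega : measurableType d)
    (F : set (set Omega)) : Prop :=
  sigma_algebra setT F /\ F `<=` measurable.

(* Y is a version of E[X | F]. *)
Definition is_cond_exp (R : realType) (d : measure_display)
    (Omega : measurableType d) (P : probability Omega R)
    (F : set (set Omega)) (X Y : Omega -> R) : Prop :=
  [/\ forall B : set R, measurable B -> F (Y @^-1` B),
      P.-integrable setT (EFin \o Y) &
      forall A, F A ->
        (\int[P]_(w in A) (Y w)%:E = \int[P]_(w in A) (X w)%:E)%E].

(* The set C_p. *)
Definition coherent (R : realType) (p : R) : set (plane_prob R) :=
  [set mu | on_unit_square mu /\
    exists (d : measure_display) (Omega : measurableType d)
           (P : probability Omega R) (X : {RV P >-> R})
           (F1 F2 : set (set Omega)) (X1 X2 : Omega -> R),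
      [/\ (forall w, X w = 0 \/ X w = 1) /\ ('E_P[X] = p%:E)%E,
          sub_sigma_algebra F1 /\ sub_sigma_algebra F2,
          is_cond_exp P F1 X X1,
          is_cond_exp P F2 X X2 &
          forall A : set (R * R), measurable A ->
            mu A = P ((fun w => (X1 w, X2 w)) @^-1` A)]].

Definition objective (R : realType) (alpha beta p : R) (z : R * R) : R :=
  alpha * (z.1 - z.2) ^+ 2 + beta * (z.1 + z.2 - 2 * p) ^+ 2.

Definition integral_obj (R : realType) (alpha beta p : R) (mu : plane_prob R) :
    \bar R :=
  (\int[mu]_z (objective alpha beta p z)%:E)%E.

(* The maximum of the integral over C_p exists, i.e. is attained, and is M. *)
Definition is_max_integral (R : realType) (alpha beta p M : R) : Prop :=
  (exists2 mu, coherent p mu & integral_obj alpha beta p mu = M%:E) /\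
  (forall mu, coherent p mu -> (integral_obj alpha beta p mu <= M%:E)%E).

Definition optimal (R : realType) (alpha beta p : R) (mu : plane_prob R) :
    Prop :=
  coherent p mu /\
  forall nu, coherent p nu ->
    (integral_obj alpha beta p nu <= integral_obj alpha beta p mu)%E.

Definition support_of (R : realType) (mu : plane_prob R) : set (R * R) :=
  [set z | forall U : set (R * R), open U -> U z -> (0 < mu U)%E].

Definition monotone_seq (R : realType) (s : seq R) : Prop :=
  sorted (fun a b => a <= b) s \/ sorted (fun a b => b <= a) s.

Definition is_ladder (R : realType) (s : seq (R * R)) : Prop :=
  [/\ uniq s,
      monotone_seq (map fst s) /\ monotone_seq (map snd s),
      sorted (fun z z' : R * R => (z.1 == z'.1) || (z.2 == z'.2)) s &
      forall c : R, (count (fun z : R * R => z.1 == c) s <= 2)%N /\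
                    (count (fun z : R * R => z.2 == c) s <= 2)%N].

Definition ladder_distribution (R : realType) (n : nat) (mu : plane_prob R) :
    Prop :=
  on_unit_square mu /\
  exists s : seq (R * R),
    [/\ size s = n, is_ladder s & support_of mu = [set` s]].

(* Neither component is required to be coherent, and the weight may be 0 or 1. *)
Definition convex_comb_of_two_ladders (R : realType) (n : nat)
    (mu : plane_prob R) : Prop :=
  exists (t : R) (mu1 mu2 : plane_prob R),
    [/\ 0 <= t <= 1,
        ladder_distribution n mu1,
        ladder_distribution n mu2 &
        forall A : set (R * R), measurable A ->
          mu A = (t%:E * mu1 A + (1 - t)%:E * mu2 A)%E].

(* The three conditions are meaningful only for 0 < alpha; together with
   2 * beta <= alpha they then force 0 < N. *)
Definition condition1 (R : realType) (alpha beta p : R) (N : nat) : Prop :=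
  (alpha - beta) / alpha = N%:R /\
  (2 - alpha / (alpha - beta)) * p <= 1
    <= (2 - alpha / (alpha - beta)) * p + alpha / (alpha - beta).

Definition condition2 (R : realType) (alpha beta p : R) (N : nat) : Prop :=
  (2 * (alpha - beta) - (alpha - 2 * beta) * p) / alpha = N%:R /\
  1 < (2 - alpha / (alpha - beta)) * p + alpha / (alpha - beta).

Definition condition3 (R : realType) (alpha beta p : R) (N : nat) : Prop :=
  (2 * (alpha - beta) - (alpha - 2 * beta) * (1 - p)) / alpha = N%:R /\
  (2 - alpha / (alpha - beta)) * p < 1.

(* Main.v *)
Require Import Defs.
From HB Require Import structures.
From mathcomp Require Import all_boot all_order all_algebra.
From mathcomp Require Import all_classical all_reals all_analysis.
From mathcomp Require Import measurable_realfun ring lra zify.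

Set Implicit Arguments.
Unset Strict Implicit.
Unset Printing Implicit Defensive.

Import Order.TTheory GRing.Theory Num.Theory.
Import numFieldNormedType.Exports.

Local Open Scope classical_set_scope.
Local Open Scope ring_scope.

(** Write [Y = X - p], [S = X1 + X2 - 2 p] and [D = X1 - X2]. All that coherence says about
second moments is [E[X1 (X - X1)] = E[X2 (X - X2)] = 0], together with [E X1 = E X2 = E X = p].
Hence [E (S^2 + D^2) = 2 E (Y S)], and the objective [E (alpha D^2 + beta S^2)] can be rewritten
as [2 alpha E (Y S) - (alpha - beta) E S^2]; completing the square gives

  [E f = p (1 - p) alpha^2 / (alpha - beta) - (alpha - beta) E (S - lambda Y)^2]

with [lambda = alpha / (alpha - beta)] ([value_deficit]). This is the upper bound when [alpha >=
max (0, 2 beta)]. In the other range the same relation shows that the objective is at most [max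
(0, 4 beta) p (1 - p)] ([value_le_easy]), and the two extreme forecasters, who know nothing or
everything, reach this value.

Equality in the bound means that [X1 + X2 = b + lambda X] almost surely, where [b = (2 - lambda)
p]. Start from a value [x] of the first expert. Unless [x = 0], the event [X = 1] has positive
conditional probability, and then the second expert says [b + lambda - x]; unless this is 1, the
event [X = 0] is possible given it, and then the first expert says [x - lambda]. So the values
of the first expert go down by steps [lambda] until they hit a place where the walk is stuck,
and symmetrically up. Since they stay in [[0, 1]], both walks stop, and comparing the two end
points yields exactly the three arithmetic conditions ([descent], [two_ended_chain],
[equality_condition]).

Conversely, when one of these conditions holds, such a walk from one end to the other is a
finite chain of points in which consecutive points share alternately their ordinate and their
abscissa. Masses chosen so that [X] has the right conditional probability at each inner vertex
make it a coherent law ([chain_attains]); its support is a ladder. The walk has [2 N - 1] points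
under conditions 2 and 3. Under condition 1 it has [2 N] points, unless condition 2 or 3 holds
as well for the same [N], and it is cut into two overlapping ladders with [2 N - 1] points
([split_ladder]). When [alpha = 2 beta], so that [lambda = 2], the walk cannot leave 0 or 1; the
optimal law is then the one of two experts who know the outcome, carried by the two points (0,
0) and (1, 1).

In general the maximum is below the bound, and that it is attained is a compactness statement.
The joint law of [X] and the binary digits of [X1] and [X2] is given by the probabilities of
finite binary words. A cluster point of such weights along a maximising sequence is again a
consistent system of weights, and cutting [[0, 1[] into nested intervals realises it by random
digits on the Lebesgue space ([model_compactness]). Calibration is stable under this limit
because it can be tested on Lipschitz functions of the forecasts, which depend on finitely many
digits up to a small error ([calibrated_limit]). *)

(** * Expectations of bounded measurable functions *)

Section BoundedExpectation.
Context (R : realType) (d : measure_display) (T : measurableType d).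
Implicit Types (f g : T -> R) (P : probability T R).

(** Bounded measurable functions: an algebra on which the expectation is linear and finite. *)
Definition bmf f := measurable_fun setT f /\ exists C, forall w, `|f w| <= C.

Lemma bmf_cst (c : R) : bmf (fun=> c).
Proof. by split; [exact: measurable_cst|exists `|c|]. Qed.

Lemma bmfD f g : bmf f -> bmf g -> bmf (fun w => f w + g w).
Proof.
move=> [mf [C fC]] [mg [D gD]]; split; first exact: measurable_funD.
by exists (C + D) => w; rewrite (le_trans (ler_normD _ _))// lerD.
Qed.

Lemma bmfN f : bmf f -> bmf (fun w => - f w).
Proof.
move=> [mf [C fC]]; split; last by exists C => w; rewrite normrN.
exact: measurableT_comp.
Qed.

Lemma bmfM f g : bmf f -> bmf g -> bmf (fun w => f w * g w).
Proof.
move=> [mf [C fC]] [mg [D gD]]; split; first exact: measurable_funM.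
by exists (C * D) => w; rewrite normrM ler_pM.
Qed.

Lemma bmfX f n : bmf f -> bmf (fun w => f w ^+ n).
Proof.
move=> bf; elim: n => [|n IH]; first exact: bmf_cst.
by under eq_fun do rewrite exprS; exact: bmfM.
Qed.

Lemma bmf_sum (I : Type) (s : seq I) (F : I -> T -> R) :
  (forall i, bmf (F i)) -> bmf (fun w => \sum_(i <- s) F i w).
Proof.
move=> bF; elim: s => [|i s IH].
  by under eq_fun do rewrite big_nil; exact: bmf_cst.
by under eq_fun do rewrite big_cons; exact: bmfD.
Qed.

Lemma bmf_indic (A : set T) : measurable A -> bmf (\1_A : T -> R).
Proof.
move=> mA; split; first exact: measurable_indic.
by exists 1 => w; rewrite indicE normr_nat; case: (w \in A).
Qed.

Lemma bmf_unit f : measurable_fun setT f -> (forall w, 0 <= f w <= 1) -> bmf f.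
Proof.
by move=> mf f01; split=> //; exists 1 => w; case/andP: (f01 w) => ? ?; rewrite ger0_norm.
Qed.

Lemma bmf_bool (B : T -> bool) :
  measurable_fun setT B -> bmf (fun w => (B w)%:R : R).
Proof.
move=> mB; have mB1 : measurable (B @^-1` [set true]).
  by rewrite -[X in measurable X]setTI; exact: mB.
suff -> : (fun w => (B w)%:R : R) = \1_(B @^-1` [set true]) by exact: bmf_indic.
apply/funext => w; rewrite indicE; congr (_%:R); congr nat_of_bool.
by apply/idP/idP; rewrite inE.
Qed.

Lemma bmf_integrable P f : bmf f -> P.-integrable setT (EFin \o f).
Proof.
move=> [mf [C fC]]; apply: (@le_integrable _ _ _ _ _ measurableT _ (cst C%:E)).
- exact/measurable_EFinP.
- by move=> x _; rewrite /= lee_fin (le_trans (fC x))// ler_norm.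
- exact: finite_measure_integrable_cst.
Qed.

(** The expectation as a real number, so that identities between moments become plain algebra.
*)
Definition Ex P f : R := \int[P]_w f w.

Lemma Ex_cst P c : Ex P (fun=> c) = c.
Proof. rewrite /Ex Rintegral_cst// -[RHS]mulr1; congr (_ * _).
by rewrite -[1]/(fine 1%E); congr fine; exact: probability_setT.
Qed.

Lemma ExD P f g : bmf f -> bmf g -> Ex P (fun w => f w + g w) = Ex P f + Ex P g.
Proof. by move=> bf bg; rewrite /Ex RintegralD//; exact: bmf_integrable. Qed.

Lemma ExB P f g : bmf f -> bmf g -> Ex P (fun w => f w - g w) = Ex P f - Ex P g.
Proof. by move=> bf bg; rewrite /Ex RintegralB//; exact: bmf_integrable. Qed.

Lemma ExZ P c f : bmf f -> Ex P (fun w => c * f w) = c * Ex P f.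
Proof. by move=> bf; rewrite /Ex RintegralZl//; exact: bmf_integrable. Qed.

Lemma Ex_sum P (I : Type) (s : seq I) (F : I -> T -> R) :
  (forall i, bmf (F i)) ->
  Ex P (fun w => \sum_(i <- s) F i w) = \sum_(i <- s) Ex P (F i).
Proof.
move=> bF; elim: s => [|i s IH].
  by under eq_fun do rewrite big_nil; rewrite Ex_cst big_nil.
under eq_fun do rewrite big_cons.
by rewrite ExD// ?IH ?big_cons//; exact: bmf_sum.
Qed.

Lemma Ex_le P f g : bmf f -> bmf g -> (forall w, f w <= g w) -> Ex P f <= Ex P g.
Proof. by move=> bf bg fg; apply: le_Rintegral => //; exact: bmf_integrable. Qed.

Lemma Ex_ge0 P f : (forall w, 0 <= f w) -> 0 <= Ex P f.
Proof. by move=> f0; apply: Rintegral_ge0 => w _. Qed.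

Lemma Ex_normle P f e : bmf f -> (forall w, `|f w| <= e) -> `|Ex P f| <= e.
Proof.
move=> bf fe; have h w : - e <= f w <= e by rewrite -ler_norml.
rewrite ler_norml -{1}(Ex_cst P (- e)) -{2}(Ex_cst P e).
by rewrite !Ex_le//; first [exact: bmf_cst|move=> w; case/andP: (h w)].
Qed.

Lemma EFin_Ex P f : bmf f -> (\int[P]_w (f w)%:E)%E = (Ex P f)%:E.
Proof.
move=> bf; rewrite /Ex /Rintegral fineK//.
by apply: integrable_fin_num => //; exact: bmf_integrable.
Qed.

Lemma Ex_indic P (A : set T) : measurable A -> Ex P (\1_A : T -> R) = fine (P A).
Proof. by move=> mA; rewrite /Ex /Rintegral integral_indic// setIT. Qed.

Lemma Ex_ae P f g : bmf f -> bmf g ->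
  {ae P, forall w, f w = g w} -> Ex P f = Ex P g.
Proof.
move=> [mf _] [mg _] fg; rewrite /Ex /Rintegral; congr fine.
apply: ae_eq_integral => //; [exact/measurable_EFinP|exact/measurable_EFinP|].
by apply: filterS fg => w /= -> _.
Qed.

(** This turns an extremal expectation into an almost sure identity. *)
Lemma Ex_eq0_ae P f : bmf f -> (forall w, 0 <= f w) -> Ex P f = 0 ->
  {ae P, forall w, f w = 0}.
Proof.
move=> bf f0 Ef; have := EFin_Ex P bf; rewrite Ef => If.
have /= : (\int[P]_w `|(f w)%:E| = 0)%E.
  by rewrite -[RHS]If; apply: eq_integral => w _; rewrite gee0_abs// lee_fin.
have mf : measurable_fun setT (EFin \o f) by apply/measurable_EFinP; case: bf.
move/(ae_eq_integral_abs P measurableT mf).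
by apply: filterS => w /= /(_ I) [].
Qed.

End BoundedExpectation.

Ltac bmft := repeat first
  [ eassumption | exact: bmf_cst | apply: bmfD | apply: bmfN | apply: bmfX | apply: bmfM ].

(** * Binary digits and conditional expectations *)

Section BinaryDigits.
Context (R : realType).
Implicit Types x : R.

(** [dtail x n] is what remains of [x] after [n] binary digits, rescaled to the unit interval.
The number 1 gets the digits 1, 1, 1, and so on. *)
Fixpoint dtail x n : R :=
  if n is k.+1 then 2 * dtail x k - (2^-1 <= dtail x k)%R%:R else x.

Definition digit x n : bool := 2^-1 <= dtail x n.

Definition dsum (b : nat -> bool) n : R := \sum_(i < n) (b i)%:R / 2 ^+ i.+1.

Lemma dtail_unit x n : 0 <= x <= 1 -> 0 <= dtail x n <= 1.
Proof.
move=> x01; elim: n => [//|n] /=.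
by case: (lerP 2^-1 (dtail x n)) => h /= /andP[h0 h1]; apply/andP; split; lra.
Qed.

Lemma dsum_digit x n : x = dsum (digit x) n + dtail x n / 2 ^+ n.
Proof.
elim: n => [|n IH]; first by rewrite /dsum big_ord0 add0r expr0 divr1.
rewrite {1}IH /dsum big_ord_recr /= -/(digit x n).
by rewrite exprS; field; rewrite expf_neq0.
Qed.

Lemma measurable_dtail n : measurable_fun setT (fun x : R => dtail x n).
Proof.
elim: n => [|n IH] /=; first exact: measurable_id.
apply: measurable_funB.
  by apply: measurable_funM => //; exact: measurable_cst.
have mb : measurable_fun setT (fun x => 2^-1 <= dtail x n).
  by apply: measurable_fun_ler => //; exact: measurable_cst.
by have [] := bmf_bool R mb.
Qed.

Lemma measurable_digit n : measurable_fun setT (fun x : R => digit x n).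
Proof.
by apply: measurable_fun_ler; [exact: measurable_cst|exact: measurable_dtail].
Qed.

(** The error is uniform in [x]: this is what lets finite sums of indicators replace functions.
*)
Lemma dsum_approx x n : 0 <= x <= 1 -> `|x - dsum (digit x) n| <= 2 ^- n.
Proof.
move=> x01; rewrite {1}(dsum_digit x n) addrC addrA (addrC (- _)) subrr add0r.
have /andP[t0 t1] := dtail_unit n x01.
rewrite ger0_norm ?divr_ge0 ?exprn_ge0//.
by rewrite ler_piMl// invr_ge0 exprn_ge0.
Qed.

End BinaryDigits.

(** Used to close every approximation by [n] binary digits. *)
Lemma le_pow2_eq0 (R : realType) (x C : R) :
  (forall n, `|x| <= C * 2 ^- n) -> x = 0.
Proof.
move=> h; apply/eqP; rewrite -normr_le0.
have cv : (fun n => C * 2 ^- n) @ \oo --> (0 : R).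
  rewrite -(mulr0 C); apply: cvgMr.
  under eq_fun do rewrite -exprVn.
  by apply: cvg_expr; rewrite ger0_norm ?invr_ge0//; lra.
by apply: (cvgr_to_ge cv); exact: nearW.
Qed.

(** Each binary digit of [g (Y w)] is an indicator of a Borel set of values of [Y], so the
hypothesis gives the claim for the truncations of [g], which approximate [g] uniformly. *)
Lemma Ex_pullout (R : realType) d (T : measurableType d) (P : probability T R)
    (Y Z : T -> R) (g : R -> R) :
  measurable_fun setT Y -> bmf Z ->
  (forall B, measurable B -> Ex P (fun w => \1_B (Y w) * Z w) = 0) ->
  measurable_fun setT g -> (forall w, 0 <= g (Y w) <= 1) ->
  Ex P (fun w => g (Y w) * Z w) = 0.
Proof.
move=> mY bZ YZ0 mg g01.
have [mZ [C ZC]] := bZ.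
have mgY : measurable_fun setT (g \o Y) by exact: measurableT_comp.
have bgY : bmf (g \o Y) by apply: bmf_unit.
have bdig i : bmf (fun w => (digit (g (Y w)) i)%:R : R).
  by apply: bmf_bool; exact: (measurableT_comp (@measurable_digit R i) mgY).
have bsum n : bmf (fun w => dsum R (digit (g (Y w))) n).
  by apply: bmf_sum => i; apply: bmfM => //; exact: bmf_cst.
apply: (@le_pow2_eq0 _ _ C) => n.
rewrite (_ : Ex P _ = Ex P (fun w => (g (Y w) - dsum R (digit (g (Y w))) n) * Z w)).
  apply: Ex_normle => [|w].
    by apply: bmfM => //; apply: bmfD => //; exact: bmfN.
  rewrite normrM mulrC ler_pM// ?dsum_approx//.
rewrite (_ : (fun w => (_ - _) * _) = (fun w => g (Y w) * Z w - dsum R (digit (g (Y w))) n * Z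
    w)); last first.
  by apply/funext => w; rewrite mulrBl.
rewrite ExB; [|exact: bmfM|exact: bmfM].
rewrite [X in _ - X](_ : _ = 0) ?subr0//.
rewrite (_ : (fun w => _) = (fun w => \sum_(i < n) (2 ^- i.+1) * ((digit (g (Y w)) i)%:R * Z
    w))); last first.
  by apply/funext => w; rewrite /dsum mulr_suml; apply: eq_bigr => i _;
      rewrite mulrAC mulrC mulrA.
rewrite Ex_sum => [|i]; last by apply: bmfM; [exact: bmf_cst|exact: bmfM].
rewrite big1// => i _; rewrite ExZ; last exact: bmfM.
have mA : measurable [set x | digit (g x) i].
  by have := measurableT_comp (@measurable_digit R i) mg; move/(_ measurableT [set true] I);
      rewrite setTI.
rewrite (_ : (fun w => _) = (fun w => \1_[set x | digit (g x) i] (Y w) * Z w)).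
  by rewrite YZ0 ?mulr0.
apply/funext => w; rewrite indicE; congr (_%:R * _); congr nat_of_bool.
by apply/idP/idP; rewrite inE.
Qed.

(** * Calibrated models and coherent laws *)

(** A random [outcome] with the forecasts of two experts. The forecasts are in the unit interval
everywhere, and not only almost surely, which keeps all functions of them bounded. *)
Record model (R : realType) := Model {
  mdisp : measure_display;
  mspace : measurableType mdisp;
  mprob : probability mspace R;
  outcome : mspace -> bool;
  expert1 : mspace -> R;
  expert2 : mspace -> R;
  measurable_outcome : measurable_fun setT outcome;
  measurable_expert1 : measurable_fun setT expert1;
  measurable_expert2 : measurable_fun setT expert2;
  expert1_unit : forall w, 0 <= expert1 w <= 1;
  expert2_unit : forall w, 0 <= expert2 w <= 1 }.

Arguments outcome {R} m w.
Arguments expert1 {R} m w.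
Arguments expert2 {R} m w.

Section Models.
Context (R : realType).
Implicit Types (M : model R) (mu : plane_prob R).

Definition outcomeR M w : R := (outcome M w)%:R.
Arguments outcomeR M w : clear implicits.
Definition expect M (f : mspace M -> R) : R := Ex (mprob M) f.

Lemma bmf_outcomeR M : bmf (outcomeR M).
Proof. by apply: bmf_bool; exact: measurable_outcome. Qed.

Lemma bmf_expert1 M : bmf (expert1 M).
Proof. by apply: bmf_unit; [exact: measurable_expert1|exact: expert1_unit]. Qed.

Lemma bmf_expert2 M : bmf (expert2 M).
Proof. by apply: bmf_unit; [exact: measurable_expert2|exact: expert2_unit]. Qed.

(** The forecasts are the conditional expectations of the outcome given themselves. The
sigma-algebras of a coherent law can always be shrunk to the ones that the forecasts generate.
*)
Definition calibrated p M := [/\ expect (outcomeR M) = p,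
  forall B, measurable B ->
    expect (fun w => \1_B (expert1 M w) * (outcomeR M w - expert1 M w)) = 0 &
  forall B, measurable B ->
    expect (fun w => \1_B (expert2 M w) * (outcomeR M w - expert2 M w)) = 0].

Definition has_law M mu := forall A, measurable A ->
  mu A = mprob M ((fun w => (expert1 M w, expert2 M w)) @^-1` A).

Lemma measurable_experts M :
  measurable_fun setT (fun w => (expert1 M w, expert2 M w)).
Proof.
by apply/measurable_fun_pair; [exact: measurable_expert1|exact: measurable_expert2].
Qed.

Lemma has_law_exists M : exists mu, has_law M mu.
Proof.
pose Z : {mfun mspace M >-> (R * R)%type} := MeasurableFun.Pack
  (MeasurableFun.Class (isMeasurableFun.Build _ _ _ _ _ (@measurable_experts M))).
by exists (distribution (mprob M) Z).
Qed.

Lemma law_unit_square M mu : has_law M mu -> on_unit_square mu.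
Proof.
move=> law; rewrite /on_unit_square law; last by apply: measurableX; exact: measurable_itv.
rewrite -(probability_setT (mprob M)); congr (mprob M _).
apply/seteqP; split => // w _; split => /=; rewrite in_itv /=;
  [exact: expert1_unit|exact: expert2_unit].
Qed.

Lemma measurable_objective (al be p : R) : measurable_fun setT (objective al be p).
Proof.
apply: measurable_funD; apply: measurable_funM;
  try exact: measurable_cst; apply: measurable_funX.
  by apply: measurable_funB; [exact: measurable_fst|exact: measurable_snd].
apply: measurable_funB; last exact: measurable_cst.
by apply: measurable_funD; [exact: measurable_fst|exact: measurable_snd].
Qed.

Lemma bmf_objective M (al be p : R) :
  bmf (fun w => objective al be p (expert1 M w, expert2 M w)).
Proof.
have b1 := bmf_expert1 M; have b2 := bmf_expert2 M.
apply: bmfD; apply: bmfM; try exact: bmf_cst; apply: bmfX => /=.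
  by apply: bmfD => //; exact: bmfN.
by apply: bmfD; [exact: bmfD|exact: bmf_cst].
Qed.

Lemma integral_obj_law M mu (al be p : R) : has_law M mu ->
  integral_obj al be p mu =
  (expect (fun w => objective al be p (expert1 M w, expert2 M w)))%:E.
Proof.
move=> law; rewrite /integral_obj /expect -EFin_Ex; last exact: bmf_objective.
rewrite (@eq_measure_integral _ _ _ _
  (pushforward (mprob M) (fun w => (expert1 M w, expert2 M w)))).
- exact: measurable_experts.
- move=> mZ; rewrite integral_pushforward//.
  + by apply/measurable_EFinP; exact: measurable_objective.
  + rewrite preimage_setT.
    exact: (@bmf_integrable _ _ _ (mprob M) _ (bmf_objective M al be p)).
- by move=> mZ A mA _; exact: law.
Qed.

Lemma EFin_Ex_set d (T : measurableType d) (P : probability T R) (A : set T) f :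
  measurable A -> bmf f ->
  (\int[P]_(w in A) (f w)%:E = (Ex P (fun w => \1_A w * f w))%:E)%E.
Proof.
move=> mA bf; rewrite -EFin_Ex; last by apply: bmfM => //; exact: bmf_indic.
rewrite integral_mkcond; apply: eq_integral => w _.
rewrite /patch indicE; case: ifPn => wA; last by rewrite mul0r.
by rewrite mul1r.
Qed.

(** The sigma-algebra to take is the one generated by the forecast itself. *)
Lemma calibrated_cond_exp M (Y : mspace M -> R) :
  bmf Y ->
  (forall B, measurable B -> expect (fun w => \1_B (Y w) * (outcomeR M w - Y w)) = 0) ->
  Defs.sub_sigma_algebra (preimage_set_system setT Y measurable) /\
  is_cond_exp (mprob M) (preimage_set_system setT Y measurable) (outcomeR M) Y.
Proof.
move=> bY cal; have [mY _] := bY; split; [split|split].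
- exact/sigma_algebra_preimage/sigma_algebra_measurable.
- by move=> _ [B mB <-]; exact: mY.
- by move=> B mB; exists B => //; rewrite setTI.
- exact: bmf_integrable.
- move=> _ [B mB <-]; have mA : measurable (setT `&` Y @^-1` B) by exact: mY.
  rewrite !EFin_Ex_set//; last exact: bmf_outcomeR.
  congr EFin; apply/eqP; rewrite eq_sym -subr_eq0 -ExB.
  + apply/eqP; rewrite -[RHS](cal B mB); congr Ex; apply/funext => w.
    by rewrite -mulrBr setTI.
  + by apply: bmfM; [exact: bmf_indic|exact: bmf_outcomeR].
  + by apply: bmfM; [exact: bmf_indic|].
Qed.

Lemma calibrated_coherent p M mu : calibrated p M -> has_law M mu -> coherent p mu.
Proof.
move=> [Ep cal1 cal2] law; split; first exact: law_unit_square law.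
have mXM : measurable_fun setT (outcomeR M) by case: (bmf_outcomeR M).
pose X : {RV (mprob M) >-> R} := MeasurableFun.Pack
  (MeasurableFun.Class (isMeasurableFun.Build _ _ _ _ _ mXM)).
have [s1 c1] := calibrated_cond_exp (bmf_expert1 M) cal1.
have [s2 c2] := calibrated_cond_exp (bmf_expert2 M) cal2.
exists _, _, (mprob M), X, (preimage_set_system setT (expert1 M) measurable),
  (preimage_set_system setT (expert2 M) measurable), (expert1 M), (expert2 M).
split => //; split => //.
- by move=> w; rewrite /= /outcomeR; case: (outcome M w); [right|left].
- rewrite expectation_def -Ep; exact: (EFin_Ex (mprob M) (bmf_outcomeR M)).
Qed.

(** Projection to the unit interval: it repairs versions of a conditional expectation on a null
set. *)
Definition clamp (x : R) := Num.max 0 (Num.min 1 x).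

Lemma clamp_unit x : 0 <= clamp x <= 1.
Proof. by rewrite /clamp le_max lexx /= ge_max ler01 ge_min lexx. Qed.

Lemma clampK x : 0 <= x <= 1 -> clamp x = x.
Proof. by move=> /andP[x0 x1]; rewrite /clamp (min_r x1) (max_r x0). Qed.

Lemma measurable_clamp : measurable_fun setT clamp.
Proof.
by apply: measurable_maxr; [exact: measurable_cst|apply: measurable_minr;
  [exact: measurable_cst|exact: measurable_id]].
Qed.

(** Clamping changes the forecast on a null set only, and the clamped forecast is still
measurable with respect to [F]. *)
Lemma clamp_calibrated d (T : measurableType d) (P : probability T R)
    (F : set (set T)) (X Y : T -> R) (B : set R) :
  Defs.sub_sigma_algebra F -> is_cond_exp P F X Y -> bmf X ->
  {ae P, forall w, 0 <= Y w <= 1} -> measurable B ->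
  Ex P (fun w => \1_B (clamp (Y w)) * (X w - clamp (Y w))) = 0.
Proof.
move=> [sF FM] [mY iY cY] bX Y01 mB.
have mYT : measurable_fun setT Y.
  by move=> _ A mA; rewrite setTI; apply/FM/mY.
have mc : measurable_fun setT (fun w => clamp (Y w)).
  exact: (measurableT_comp measurable_clamp mYT).
have bc : bmf (fun w => clamp (Y w)).
  by apply: bmf_unit => // w; exact: clamp_unit.
pose A := (fun w => clamp (Y w)) @^-1` B.
have mA : measurable A by rewrite -[A]setTI; exact: mc.
have FA : F A.
  have -> : A = Y @^-1` (clamp @^-1` B) by [].
  by apply: mY; rewrite -[X in measurable X]setTI; exact: measurable_clamp.
have := cY _ FA.
rewrite (@ae_eq_integral _ _ _ _ _ (fun w => (clamp (Y w))%:E)) //; last 3 first.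
- by apply/measurable_EFinP; exact: measurable_funTS.
- by apply/measurable_EFinP; exact: measurable_funTS.
- by apply: filterS Y01 => w Y01 _; rewrite clampK.
rewrite !EFin_Ex_set// => -[] e.
rewrite -[RHS](subrr (Ex P (fun w => \1_A w * X w))) -{2}e -ExB.
- by congr Ex; apply/funext => w; rewrite -mulrBr.
- by apply: bmfM => //; exact: bmf_indic.
- by apply: bmfM => //; exact: bmf_indic.
Qed.

(** Conversely to [calibrated_coherent], every coherent law comes from a calibrated model: pass
to clamped forecasts, which changes neither the law nor the conditional expectations. *)
Lemma coherent_calibrated p mu : coherent p mu ->
  exists2 M, calibrated p M & has_law M mu.
Proof.
case=> sq [d [T [P [X [F1 [F2 [X1 [X2]]]]]]]] [[X01 EX] [s1 s2] c1 c2 law].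
have mX1 : measurable_fun setT X1.
  by case: s1 c1 => _ FM [mY _ _] _ A mA; rewrite setTI; apply/FM/mY.
have mX2 : measurable_fun setT X2.
  by case: s2 c2 => _ FM [mY _ _] _ A mA; rewrite setTI; apply/FM/mY.
have msq : measurable (`[0, 1] `*` `[0, 1] : set (R * R)).
  by apply: measurableX; exact: measurable_itv.
have mZ : measurable_fun setT (fun w => (X1 w, X2 w)) by exact/measurable_fun_pair.
have ae : {ae P, forall w, (0 <= X1 w <= 1) /\ (0 <= X2 w <= 1)}.
  exists (~` ((fun w => (X1 w, X2 w)) @^-1` (`[0, 1] `*` `[0, 1]))); split.
  - by apply: measurableC; rewrite -[X in measurable X]setTI; exact: mZ.
  - rewrite probability_setC; last by rewrite -[X in measurable X]setTI; exact: mZ.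
    by rewrite -law// sq subee.
  - move=> w /= h; apply: contra_not h => -[/=].
    by rewrite !in_itv.
have ae1 : {ae P, forall w, 0 <= X1 w <= 1} by apply: filterS ae => w [].
have ae2 : {ae P, forall w, 0 <= X2 w <= 1} by apply: filterS ae => w [].
have mo : measurable_fun setT (fun w => X w == 1).
  by apply: measurable_fun_eqr => //; exact: measurable_cst.
have mc1 := measurableT_comp measurable_clamp mX1.
have mc2 := measurableT_comp measurable_clamp mX2.
pose M := @Model R d T P (fun w => X w == 1) (clamp \o X1) (clamp \o X2)
  mo mc1 mc2 (fun w => clamp_unit _) (fun w => clamp_unit _).
have XE : outcomeR M = X.
  apply/funext => w; rewrite /outcomeR /=; case: (X01 w) => ->; last by rewrite eqxx.
  by rewrite eq_sym oner_eq0.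
have bX : bmf X by rewrite -XE; exact: (bmf_outcomeR M).
exists M; first split.
- by have := EX; rewrite /expect XE expectation_def (EFin_Ex P bX) => -[].
- move=> B mB; rewrite /expect XE; exact: (clamp_calibrated s1 c1 bX ae1 mB).
- move=> B mB; rewrite /expect XE; exact: (clamp_calibrated s2 c2 bX ae2 mB).
- move=> A mA; rewrite law//.
  have mZ' := @measurable_experts M.
  apply/eqP; rewrite eq_le; apply/andP.
  have h (f g : T -> R * R) : measurable_fun setT f -> measurable_fun setT g ->
      {ae P, forall w, f w = g w} -> (P (f @^-1` A) <= P (g @^-1` A))%E.
    move=> mf mg fg; have mfA : measurable (f @^-1` A) by rewrite -[X in measurable X]setTI;
        exact: mf.
    have mgA : measurable (g @^-1` A) by rewrite -[X in measurable X]setTI; exact: mg.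
    case: fg => N [mN N0 sub].
    have -> : P (g @^-1` A) = P (g @^-1` A `|` N) by rewrite measureU0.
    apply: le_measure; rewrite ?inE//; first exact: measurableU.
    move=> w fA; have [e|ne] := pselect (f w = g w); first by left; rewrite /preimage /= -e.
    by right; exact: sub.
  split; apply: h => //; apply: filterS ae => w [h1 h2] /=; by rewrite !clampK.
Qed.

End Models.
Arguments outcomeR {R} M w.

(** * Second moments of calibrated models *)

Section CalibratedModels.
Context (R : realType) (p : R) (M : model R).
Hypothesis cal : calibrated p M.
Local Notation c := (outcomeR M).
Local Notation x := (expert1 M).
Local Notation y := (expert2 M).

Let bc : bmf c. Proof. exact: (bmf_outcomeR M). Qed.
Let bx : bmf x. Proof. exact: (bmf_expert1 M). Qed.
Let bY : bmf y. Proof. exact: (bmf_expert2 M). Qed.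

(** Calibration tested on [z] itself and on constants: the orthogonality behind all second
moments. *)
Lemma self_pullout (z : mspace M -> R) : bmf z -> (forall w, 0 <= z w <= 1) ->
  (forall B, measurable B -> expect (fun w => \1_B (z w) * (c w - z w)) = 0) ->
  expect (fun w => z w * (c w - z w)) = 0 /\ expect (fun w => c w - z w) = 0.
Proof.
move=> bz z01 cz; have bcz : bmf (fun w => c w - z w) by apply: bmfD => //; exact: bmfN.
have [mz _] := bz.
split; first exact: (@Ex_pullout _ _ _ (mprob M) z (fun w => c w - z w) id).
rewrite -[RHS](cz _ measurableT); congr Ex; apply/funext => w.
by rewrite indicT mul1r.
Qed.

(** A combination of the orthogonality relations: it has mean zero, so it may be added to the
objective before comparing pointwise. *)
Definition residual w := (x w - p) * (c w - x w) + (y w - p) * (c w - y w).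

Lemma bmf_residual : bmf residual.
Proof. by rewrite /residual; bmft. Qed.

Lemma mean_residual : expect residual = 0.
Proof.
have [_ cal1 cal2] := cal.
have [sx ex] := self_pullout bx (@expert1_unit R M) cal1.
have [sy ey] := self_pullout bY (@expert2_unit R M) cal2.
rewrite (_ : residual = fun w => (x w * (c w - x w) + - p * (c w - x w)) +
   (y w * (c w - y w) + - p * (c w - y w))); last by apply/funext => w; rewrite /residual; ring.
rewrite /expect !ExD ?ExZ; try bmft.
by rewrite -/expect in sx ex sy ey *; rewrite [Ex _ _]sx [Ex _ _]ex [Ex _ _]sy [Ex _ _]ey
    !mulr0 !addr0.
Qed.

Lemma outcome_variance : expect (fun w => (c w - p) ^+ 2) = p * (1 - p).
Proof.
have [cp _ _] := cal.
rewrite (_ : (fun w => _) = fun w => (1 - 2 * p) * c w + p ^+ 2); last first.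
  by apply/funext => w; rewrite /outcomeR; case: (outcome M w) => /=; ring.
rewrite /expect ExD ?ExZ ?Ex_cst; try bmft.
by rewrite [Ex _ _]cp; ring.
Qed.

Definition value al be := expect (fun w => objective al be p (x w, y w)).

(** A multiple of [residual] serves as a Lagrange multiplier: it is enough to compare the
corrected objective with a multiple of [(X - p)^2] pointwise. *)
Lemma value_le al be K k :
  (forall w, objective al be p (x w, y w) + k * residual w <= K * (c w - p) ^+ 2) ->
  value al be <= K * (p * (1 - p)).
Proof.
move=> le; have bo := bmf_objective M al be p; have br := bmf_residual.
rewrite -outcome_variance -[value _ _]addr0 -(mulr0 k) -mean_residual.
rewrite /value /expect -!ExZ -?ExD; try bmft.
by apply: Ex_le => //; bmft.
Qed.

(** For [0 <= beta] take the multiplier [4 beta]: the gap is then a sum of two squares with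
nonnegative coefficients. For [beta < 0] the objective itself is nonpositive. *)
Lemma value_le_easy al be : al < 0 \/ al < 2 * be ->
  value al be <= Num.max 0 (Num.max (4 * be) (al + be)) * (p * (1 - p)).
Proof.
move=> h; have [be0|be0] := leP 0 be.
- have -> : Num.max 0 (Num.max (4 * be) (al + be)) = 4 * be.
    by rewrite (@max_l _ _ (4 * be)) ?max_r//; case: h => h; lra.
  apply: (value_le (k := 4 * be)) => w; rewrite /objective /residual /=.
  rewrite -subr_ge0 (_ : _ - _ = (2 * be - al) * (x w - y w) ^+ 2 +
    be * (x w + y w - 2 * p - 2 * (c w - p)) ^+ 2); last by ring.
  by rewrite addr_ge0// mulr_ge0 ?sqr_ge0//; case: h => h; lra.
- have -> : Num.max 0 (Num.max (4 * be) (al + be)) = 0.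
    by rewrite max_l// ge_max; apply/andP; split; case: h => h; lra.
  apply: (value_le (k := 0)) => w; rewrite /objective /= !mul0r addr0.
  have : 0 <= - al * (x w - y w) ^+ 2 by rewrite mulr_ge0 ?sqr_ge0//; case: h => h; lra.
  have : 0 <= - be * (x w + y w - 2 * p) ^+ 2 by rewrite mulr_ge0 ?sqr_ge0//; lra.
  lra.
Qed.

(** The multiplier [2 alpha] turns the objective into a quadratic form of [S] and [Y] alone, and
the square is completed. *)
Lemma value_deficit al be : al - be != 0 ->
  value al be + (al - be) *
    expect (fun w => (x w + y w - 2 * p - al / (al - be) * (c w - p)) ^+ 2) =
  p * (1 - p) * (al ^+ 2 / (al - be)).
Proof.
move=> ab; have bo := bmf_objective M al be p; have br := bmf_residual.
rewrite -outcome_variance -[value _ _]addr0 -(mulr0 (2 * al)) -mean_residual.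
rewrite (mulrC (expect _)) /value /expect -!ExZ -?ExD; try bmft.
by congr Ex; apply/funext => w; rewrite /objective /residual /=; field.
Qed.

End CalibratedModels.

Section Mirror.
Context (R : realType) (M : model R).

Let mm (z : mspace M -> R) : measurable_fun setT z -> measurable_fun setT (fun w => 1 - z w).
Proof. by move=> mz; apply: measurable_funB => //; exact: measurable_cst. Qed.

Let mo : measurable_fun setT (fun w => ~~ outcome M w).
Proof. by apply: measurable_neg; exact: measurable_outcome. Qed.

Let mu (z : mspace M -> R) : (forall w, 0 <= z w <= 1) -> forall w, 0 <= 1 - z w <= 1.
Proof. by move=> h w; have := h w; lra. Qed.

(** The complementary event with the complementary forecasts; it exchanges the two ends of [[0,
1]]. *)
Definition mirror := @Model R _ _ (mprob M) _ _ _ mo (mm (@measurable_expert1 R M))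
  (mm (@measurable_expert2 R M)) (mu (@expert1_unit R M)) (mu (@expert2_unit R M)).

Lemma mirror_outcome w : outcomeR mirror w = 1 - outcomeR M w.
Proof. by rewrite /outcomeR /=; case: (outcome M w); rewrite ?subrr ?subr0. Qed.

Lemma calibrated_mirror p : calibrated p M -> calibrated (1 - p) mirror.
Proof.
move=> [cp cal1 cal2].
have aux (z : mspace M -> R) : (forall B, measurable B -> expect (fun w => \1_B (z w) *
    (outcomeR M w - z w)) = 0) ->
  bmf z -> forall B, measurable B -> Ex (mprob M) (fun w => \1_B (1 - z w) * (outcomeR mirror
      w - (1 - z w))) = 0.
  move=> cz bz B mB; pose B' := (fun t : R => 1 - t) @^-1` B.
  have mB' : measurable B'.
    rewrite -[B']setTI; apply: measurable_funB => //; exact: measurable_cst.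
  rewrite (_ : (fun w => _) = (fun w => -1 * (\1_B' (z w) * (outcomeR M w - z w)))).
    rewrite ExZ; first by rewrite [Ex _ _]cz// mulr0.
    apply: bmfM; last by apply: bmfD; [exact: (bmf_outcomeR M)|exact: bmfN].
    have [mz _] := bz.
    have -> : (fun w => \1_B' (z w) : R) = \1_(z @^-1` B') by apply/funext => w; rewrite !indicE.
    by apply: bmf_indic; rewrite -[X in measurable X]setTI; exact: mz.
  by apply/funext => w; rewrite mirror_outcome !indicE /B' (_ : (_ \in _) = (1 - z w \in B));
      [ring|apply/idP/idP; rewrite !inE].
split.
- rewrite -cp /expect (_ : outcomeR mirror = fun w => 1 - outcomeR M w);
    last exact/funext/mirror_outcome.
  by rewrite ExB ?Ex_cst//; [exact: bmf_cst|exact: (bmf_outcomeR M)].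
- exact: aux cal1 (bmf_expert1 M).
- exact: aux cal2 (bmf_expert2 M).
Qed.

End Mirror.

(** * Descent along the values of an expert *)

Section Descent.
Context (R : realType).
Implicit Types (M : model R).

Lemma bmf_indic_comp M (z : mspace M -> R) (B : set R) :
  bmf z -> measurable B -> bmf (fun w => \1_B (z w) : R).
Proof.
move=> [mz _] mB; have -> : (fun w => \1_B (z w) : R) = \1_(z @^-1` B).
  by apply/funext => w; rewrite !indicE.
by apply: bmf_indic; rewrite -[X in measurable X]setTI; exact: mz.
Qed.

(** If [z] takes values in [B] only when the outcome is 0, then the mean of [z] on that event is
the probability of outcome 1 there, that is 0. *)
Lemma null_outcome1 M (z : mspace M -> R) (B : set R) :
  bmf z -> (forall w, 0 <= z w <= 1) -> measurable B ->
  expect (fun w => \1_B (z w) * (outcomeR M w - z w)) = 0 ->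
  {ae mprob M, forall w, outcome M w -> ~ B (z w)} ->
  {ae mprob M, forall w, B (z w) -> z w = 0}.
Proof.
move=> bz z01 mB cz nu; have b1 := bmf_indic_comp bz mB; have bc := bmf_outcomeR M.

have e1 : Ex (mprob M) (fun w => \1_B (z w) * outcomeR M w) = 0.
  rewrite -[RHS](Ex_cst (mprob M)); apply: Ex_ae; try bmft.
  apply: filterS nu => w nB; rewrite /outcomeR.
  have [ow |] := boolP (outcome M w); last by rewrite mulr0.
  by rewrite indicE memNset ?mul0r//; exact: nB.
have e0 : Ex (mprob M) (fun w => \1_B (z w) * z w) = 0.
  rewrite -[RHS](subrr 0) -{1}e1 -cz /expect -ExB; try bmft.
  by congr Ex; apply/funext => w; ring.
have b1z : bmf (fun w => \1_B (z w) * z w) by bmft.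
have h0 w : 0 <= \1_B (z w) * z w by rewrite mulr_ge0//; case/andP: (z01 w).
apply: filterS (Ex_eq0_ae b1z h0 e0) => w /= + Bz.
by rewrite indicE mem_set// mul1r.
Qed.

(** The counterpart of [null_outcome1] for outcome 0. *)
Lemma null_outcome0 M (z : mspace M -> R) (B : set R) :
  bmf z -> (forall w, 0 <= z w <= 1) -> measurable B ->
  expect (fun w => \1_B (z w) * (outcomeR M w - z w)) = 0 ->
  {ae mprob M, forall w, ~~ outcome M w -> ~ B (z w)} ->
  {ae mprob M, forall w, B (z w) -> z w = 1}.
Proof.
move=> bz z01 mB cz nu; have b1 := bmf_indic_comp bz mB; have bc := bmf_outcomeR M.

have e1 : Ex (mprob M) (fun w => \1_B (z w) * (1 - outcomeR M w)) = 0.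
  rewrite -[RHS](Ex_cst (mprob M)); apply: Ex_ae; try bmft.
  apply: filterS nu => w nB; rewrite /outcomeR.
  have [ow | ow] := boolP (outcome M w); first by rewrite subrr mulr0.
  by rewrite indicE memNset ?mul0r//; exact: nB.
have e0 : Ex (mprob M) (fun w => \1_B (z w) * (1 - z w)) = 0.
  rewrite -[RHS](addr0 0) -{1}e1 -cz /expect -ExD; try bmft.
  by congr Ex; apply/funext => w; ring.
have b1z : bmf (fun w => \1_B (z w) * (1 - z w)) by bmft.
have h0 w : 0 <= \1_B (z w) * (1 - z w).
  by rewrite mulr_ge0//; have := z01 w; lra.
apply: filterS (Ex_eq0_ae b1z h0 e0) => w /= + Bz.
by rewrite indicE mem_set// mul1r => h; lra.
Qed.

Section Steps.
Variables (M : model R) (p b lam : R).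
Hypotheses (cal : calibrated p M) (lam0 : 0 < lam).
Hypothesis sumE :
  {ae mprob M, forall w, expert1 M w + expert2 M w = b + lam * outcomeR M w}.
Let a := b + lam.

(** The values from which the walk that subtracts [lam] cannot go on: at 0 the outcome 1 is
impossible, and at [a - 1] the other expert announces 1, so that outcome 0 is impossible. The
side conditions discard values that do not occur: at 0 the other expert announces [b], and [a -
1] is a forecast. *)
Definition stuck z : bool := ((z == 0) && (b <= 1)) || ((z == a - 1) && (1 <= a)).

Lemma measurable_stuck (t : R) : measurable [set z : R | stuck (z - t)].
Proof.
have m : measurable_fun setT (fun z : R => stuck (z - t)).
  have mt : measurable_fun setT (fun z : R => z - t).
    by apply: measurable_funB; [exact: measurable_id|exact: measurable_cst].
  by apply: measurable_or; apply: measurable_and; try exact: measurable_cst;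
    apply: measurable_fun_eqr => //; exact: measurable_cst.
by move/(_ measurableT [set true] I): m; rewrite setTI.
Qed.

(** One step of the walk, on null sets. If the first expert almost never says [t - lam] with [t]
in [A], then, outcome 0 being impossible there, the second expert almost never says [a - t],
except for the value 1; so outcome 1 is impossible when the first expert is in [A], except for
the value 0. Both exceptions are ruled out because [A] has no stuck value. *)
Lemma descent_step (A : set R) : measurable A ->
  (forall z, A z -> 0 <= z <= 1 -> ~~ stuck z) ->
  {ae mprob M, forall w, ~ A (expert1 M w + lam)} ->
  {ae mprob M, forall w, ~ A (expert1 M w)}.
Proof.
move=> mA As nu; have [_ cal1 cal2] := cal.
pose B := (fun t : R => a - t) @^-1` A.
have mB : measurable B.
  by rewrite -[B]setTI; apply: measurable_funB => //; exact: measurable_cst.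
have nB : {ae mprob M, forall w, ~~ outcome M w -> ~ B (expert2 M w)}.
  apply: filterS2 sumE nu => w; rewrite /outcomeR => s + o;
      rewrite (negbTE o) /= mulr0 addr0 in s.
  by rewrite /B /=; apply: contra_not; rewrite (_ : a - _ = expert1 M w + lam)//; rewrite /a; lra.
have := null_outcome0 (bmf_expert2 M) (@expert2_unit R M) mB (cal2 _ mB) nB.
move=> nB1.
have nA : {ae mprob M, forall w, outcome M w -> ~ A (expert1 M w)}.
  apply: filterS2 sumE nB1 => w; rewrite /outcomeR => s + o Aw; rewrite o /= mulr1 in s.
  have e1 : expert1 M w = a - expert2 M w by rewrite /a; lra.
  rewrite /B /= -e1 => /(_ Aw) e2.
  have := As _ Aw (expert1_unit w); rewrite /stuck negb_or !negb_and => /andP[_].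
  rewrite {1}e1 e2 eqxx /= => a1.
  by have := expert1_unit w; rewrite e1 e2; move: a1; rewrite -ltNge; lra.
have nA0 := null_outcome1 (bmf_expert1 M) (@expert1_unit R M) mA (cal1 _ mA) nA.
apply: filterS3 sumE nA nA0 => w; rewrite /outcomeR => s n0 /[swap] Aw /(_ Aw) z0.
have [ow | ow] := boolP (outcome M w); first exact: (n0 ow Aw).
rewrite (negbTE ow) /= mulr0 addr0 in s.
have := As _ Aw (expert1_unit w); rewrite /stuck negb_or !negb_and => /andP[+ _].
rewrite z0 eqxx /= -ltNge; have := expert2_unit w; lra.
Qed.

(** The values that never get stuck form a set [G] stable under subtraction of [lam]. Below 0
there are no forecasts, so [descent_step] shows by induction on [k] that [G] is null below [k *
lam]. *)
Lemma descent : {ae mprob M, forall w, exists j : nat, stuck (expert1 M w - j%:R * lam)}.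
Proof.
pose G := [set z : R | forall j : nat, ~~ stuck (z - j%:R * lam)].
have mG : measurable G.
  rewrite (_ : G = \bigcap_(j in setT) ~` [set z | stuck (z - j%:R * lam)]).
    by apply: bigcap_measurableType => j _; apply: measurableC; exact: measurable_stuck.
  apply/seteqP; split => z h; first by move=> j _ /=; apply/negP; exact: h.
  by move=> j; apply/negP; exact: (h j I).
pose A k := G `&` [set z | z < k%:R * lam].
have mA k : measurable (A k).
  apply: measurableI => //; rewrite (_ : [set _ | _] = `]-oo, (k%:R * lam)[%classic).
    exact: measurable_itv.
  by apply/seteqP; split => z /=; rewrite in_itv.
have nA k : {ae mprob M, forall w, ~ A k (expert1 M w)}.
  elim: k => [|k IH].
    by apply: aeW => w [_] /=; rewrite mul0r; have := expert1_unit w; lra.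
  apply: descent_step => // [z [Gz _] _|]; first by have := Gz 0%N; rewrite mul0r subr0.
  apply: filterS IH => w; apply: contra_not => -[Gz /= zk].
  split; last by move: zk => /=; rewrite -(natr1 k) mulrDl mul1r; lra.
  move=> j; have := Gz j.+1.
  by rewrite -(natr1 j) mulrDl mul1r (addrC (j%:R * lam)) opprD addrA addrK.
(* By the Archimedean property the range [0, 1] is exhausted after finitely many steps. *)
have [K aK] : exists K : nat, 1 < K%:R * lam.
  exists (Num.bound lam^-1); rewrite -ltr_pdivrMr// div1r.
  by apply: archi_boundP; rewrite invr_ge0 ltW.
apply: filterS (nA K) => w nAw; apply: contrapT => nj; apply: nAw; split => /=.
  by move=> j; apply/negP => sj; apply: nj; exists j.
by have := expert1_unit w; lra.
Qed.
End Steps.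

(** The descent and its mirror image meet: almost every value of the first expert is an integral
number of steps above a stuck value and below a value stuck upwards. Each of the four pairs of
end points gives one linear relation. *)
Lemma two_ended_chain M (p b lam : R) : calibrated p M -> 0 < lam ->
  {ae mprob M, forall w, expert1 M w + expert2 M w = b + lam * outcomeR M w} ->
  exists n : nat,
  [\/ [/\ 1 = n%:R * lam, b <= 1 & 1 <= b + lam],
      b = n%:R * lam /\ b <= 1 | b + lam = 2 - n%:R * lam /\ 1 <= b + lam ].
Proof.
move=> cal lam0 sumE.
have down := descent cal lam0 sumE.
have sumE' : {ae mprob (mirror M), forall w, expert1 (mirror M) w + expert2 (mirror M) w =
    (2 - b - lam) + lam * outcomeR (mirror M) w}.
  by apply: filterS sumE => w; rewrite mirror_outcome /=; lra.
have up := descent (calibrated_mirror cal) lam0 sumE'.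
have [w [[j dj] [k uk]]] : exists w, (exists j : nat, stuck b lam (expert1 M w - j%:R * lam)) /\
    (exists j : nat, stuck (2 - b - lam) lam (expert1 (mirror M) w - j%:R * lam)).
  have h : {ae mprob M, forall w, (exists j : nat, stuck b lam (expert1 M w - j%:R * lam)) /\
    (exists j : nat, stuck (2 - b - lam) lam (expert1 (mirror M) w - j%:R * lam))}.
    by apply: filterS2 down up => w ? ?; split.
  apply: contrapT => nex; have : {ae mprob M, forall w, False}.
    by apply: filterS h => w hw; apply: nex; exists w.
  move=> [N [mN N0 sub]]; have : mprob M N = 1%E.
    rewrite -(probability_setT (mprob M)); congr (mprob M _); apply/seteqP; split => // w _.
    by apply: sub.
  by rewrite N0 => -[] /eqP; rewrite eq_sym oner_eq0.
move: dj uk; rewrite /stuck /= => /orP[/andP[/eqP e1 h1]|/andP[/eqP e1 h1]]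
  /orP[/andP[/eqP e2 h2]|/andP[/eqP e2 h2]].
- by exists (j + k)%N; apply: Or31; rewrite natrD mulrDl; split => //; lra.
- by exists (j + k)%N; apply: Or32; rewrite natrD mulrDl; split => //; lra.
- by exists (j + k)%N; apply: Or33; rewrite natrD mulrDl; split => //; lra.
- by exists (j + k).+1; apply: Or31; rewrite -natr1 natrD !mulrDl; split => //; lra.
Qed.
End Descent.

(** * Limits and realisations of weights of binary words *)

(** By Tychonoff's theorem the bounded families have a cluster point, and a closed inequality on
finitely many coordinates that holds eventually also holds there. *)
Lemma cluster_weights (R : realType) (I : eqType) (u : nat -> I -> R) :
  (forall n i, 0 <= u n i <= 1) ->
  exists v : I -> R, forall (s : seq I) (phi : I -> R) (lo : R),
    (\forall n \near \oo, lo <= \sum_(i <- s) phi i * u n i) ->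
    lo <= \sum_(i <- s) phi i * v i.
Proof.
move=> u01; pose K := prod_topology (fun _ : I => R).
have /(_ (u @ \oo)) : @compact K [set f | forall i, `[0, 1]%classic (f i)].
  by apply: (@tychonoff I (fun=> R) (fun=> `[0, 1]%classic)) => i; exact: segment_compact.
case=> [|v [_]].
  by exists 0%N => // n _ i /=; rewrite in_itv /=; exact: u01.
rewrite cluster_cvgE => -[G PG [Gv uG]]; exists v => s phi lo lou.
have cv i : (fun f : K => f i) @ G --> (v i : R).
  by apply: cvg_trans (@proj_continuous I (fun=> R) i v); exact: cvg_app.
have cvs : (fun f : K => \sum_(i <- s) phi i * f i) @ G --> (\sum_(i <- s) phi i * v i : R).
  elim: s {lou} => [|i s IH].
    by under eq_fun do rewrite big_nil; rewrite big_nil; exact: cvg_cst.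
  under eq_fun do rewrite big_cons; rewrite big_cons.
  by apply: cvgD IH; apply: cvgMl_tmp; exact: cv.
apply: (cvgr_to_ge cvs).
by apply: uG; apply: lou.
Qed.

Section WordsOfDigits.
Context (T : Type) (B : nat -> T -> bool).

(** The first [n] digits, most recent first, so that a new digit is added by [cons]. *)
Fixpoint word n w : seq bool := if n is k.+1 then B k w :: word k w else [::].

Lemma size_word n w : size (word n w) = n.
Proof. by elim: n => //= n ->. Qed.

Lemma nth_rev_word n w i : (i < n)%N -> nth false (rev (word n w)) i = B i w.
Proof.
elim: n => // n IH; rewrite ltnS leq_eqVlt /= rev_cons nth_rcons size_rev size_word.
by case: ltngtP => // [lt _|-> _]; [exact: IH|].
Qed.

End WordsOfDigits.

Section Words.
Context (R : realType) (d : measure_display) (T : measurableType d).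
Variables (P : probability T R) (B : nat -> T -> bool).
Local Notation word := (word B).
Hypothesis mB : forall n, measurable_fun setT (B n).

Lemma bmf_word n (phi : seq bool -> R) : bmf (fun w => phi (word n w)).
Proof.
elim: n phi => [|n IH] phi /=; first exact: bmf_cst.
rewrite (_ : (fun w => _) = fun w => (B n w)%:R * phi (true :: word n w) +
    (1 + - (B n w)%:R) * phi (false :: word n w)); last first.
  by apply/funext => w; case: (B n w) => /=; ring.
have b1 := IH (fun s => phi (true :: s)); have b0 := IH (fun s => phi (false :: s)).
by have bB := bmf_bool R (mB n); bmft.
Qed.

Definition weight (s : seq bool) : R := Ex P (fun w => (word (size s) w == s)%:R).

Lemma weight_bounds s : 0 <= weight s <= 1.
Proof.
have b := bmf_word (size s) (fun t => (t == s)%:R).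
apply/andP; split; first by apply: Ex_ge0 => w.
by rewrite -(Ex_cst P 1); apply: Ex_le => // [|w]; [exact: bmf_cst|case: eqP].
Qed.

Lemma weight_nil : weight [::] = 1.
Proof. by rewrite -[RHS](Ex_cst P). Qed.

(** This consistency is what lets nested intervals realise the weights. *)
Lemma weight_split s : weight s = weight (false :: s) + weight (true :: s).
Proof.
rewrite /weight -ExD; last 2 first.
- exact: (bmf_word (size s).+1 (fun t => (t == false :: s)%:R)).
- exact: (bmf_word (size s).+1 (fun t => (t == true :: s)%:R)).
congr Ex; apply/funext => w /=; rewrite !eqseq_cons.
by case: (B _ w) => /=; rewrite ?addr0 ?add0r.
Qed.

Lemma Ex_word n (phi : seq bool -> R) :
  Ex P (fun w => phi (word n w)) = \sum_(t : n.-tuple bool) phi t * weight t.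
Proof.
rewrite (_ : (fun w => _) = fun w => \sum_(t : n.-tuple bool) phi t * (word n w == t)%:R).
  rewrite Ex_sum => [|t]; last by apply: bmfM;
      [exact: bmf_cst|exact: (bmf_word n (fun s => (s == t)%:R))].
  apply: eq_bigr => t _; rewrite ExZ ?/weight ?size_tuple//.
  exact: (bmf_word n (fun s => (s == t)%:R)).
apply/funext => w; have sw : size (word n w) == n by rewrite size_word.
rewrite (bigD1 (Tuple sw))//= eqxx mulr1 big1 ?addr0// => t tw.
by rewrite (_ : (_ == _) = false) ?mulr0//; apply: contra_neqF tw => /eqP e; exact/val_inj.
Qed.

End Words.

Section Realisation.
Context (R : realType) (v : seq bool -> R).
Hypotheses (v0 : forall s, 0 <= v s) (v1 : v [::] = 1)
  (vs : forall s, v s = v (false :: s) + v (true :: s)).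

(** The word [s] owns the interval that starts at [left_end s] and has length [v s]; it is cut
into the intervals of the words [false :: s] and [true :: s], in this order. *)
Fixpoint left_end s : R :=
  if s is b :: t then left_end t + (if b then v (false :: t) else 0) else 0.

Fixpoint cell_word n (x : R) : seq bool :=
  if n is k.+1 then
    let s := cell_word k x in (left_end s + v (false :: s) <= x) :: s
  else [::].

Definition cell_digit n x := head false (cell_word n.+1 x).

Lemma word_cell_digit n x : word cell_digit n x = cell_word n x.
Proof. by elim: n => //= n ->. Qed.

Lemma measurable_cell_word n (phi : seq bool -> R) :
  measurable_fun setT (fun x => phi (cell_word n x)) /\
  measurable_fun setT (cell_digit n).
Proof.
have dig k : (forall psi : seq bool -> R, measurable_fun setT (fun x => psi (cell_word k x))) ->
    measurable_fun setT (cell_digit k).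
  move=> IH; apply: measurable_fun_ler; last exact: measurable_id.
  exact: (IH (fun s => left_end s + v (false :: s))).
suff h k : forall psi : seq bool -> R, measurable_fun setT (fun x => psi (cell_word k x)).
  by split; [exact: h|apply: dig; exact: h].
elim: k => [|k IH] psi /=; first exact: measurable_cst.
rewrite (_ : (fun x => _) = fun x => if cell_digit k x then psi (true :: cell_word k x)
  else psi (false :: cell_word k x)); last by apply/funext => x; rewrite /cell_digit /=;
      case: ifP.
apply: measurable_fun_ifT; [exact: dig|exact: (IH (fun s => psi (true :: s)))|].
exact: (IH (fun s => psi (false :: s))).
Qed.

Definition cell s x := left_end s <= x < left_end s + v s.

Lemma cell_unit s x : cell s x -> 0 <= x < 1.
Proof.
elim: s => [|b s IH] /=; first by rewrite /cell /= v1 add0r.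
move=> h; apply: IH; move: h; rewrite /cell /= (vs s).
have := v0 (false :: s); have := v0 (true :: s).
by case: b => ? ? /andP[? ?]; apply/andP; split; lra.
Qed.

(** Reading off the digits of [x] by comparison with the cut points recovers the cell that
contains [x]. *)
Lemma cell_wordP s x : 0 <= x < 1 -> (cell_word (size s) x == s) = cell s x.
Proof.
move=> x01; elim: s => [|b s IH]; first by rewrite /cell /= v1 add0r x01.
rewrite /= eqseq_cons andbC IH.
have [/eqP|nc] := boolP (cell_word (size s) x == s); last first.
  rewrite -IH (negbTE nc) /=; symmetry; apply: contraNF nc; rewrite IH /cell /= (vs s).
  have := v0 (false :: s); have := v0 (true :: s).
  by case: b => ? ? /andP[? ?]; apply/andP; split; lra.
move=> e; have := IH; rewrite e eqxx => /esym; rewrite /cell /= => /andP[h1 h2]; rewrite h1 h2 /=.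
rewrite vs in h2; case: b => /=.
  rewrite eqb_id; apply/idP/andP => [h|[]//].
  by split => //; rewrite -addrA.
by rewrite eqbF_neg -ltNge addr0 h1.
Qed.

Let I01 : set (measurableTypeR R) := `[0, 1[%classic.
Let mI01 : measurable I01. Proof. exact: measurable_itv. Qed.

Definition unit_lebesgue : probability (measurableTypeR R) R :=
  mnormalize (mrestr (@lebesgue_measure R) mI01) (dirac (0 : measurableTypeR R)).

Lemma unit_lebesgueE (A : set (measurableTypeR R)) : measurable A -> unit_lebesgue A =
    lebesgue_measure (A `&` I01).
Proof.
move=> mA; have m1 : (mrestr (@lebesgue_measure R) mI01 setT = 1)%E.
  rewrite /mrestr setTI lebesgue_measure_itv /= lte_fin ltr01.
  by rewrite -EFinB subr0.
rewrite /unit_lebesgue /= /mnormalize /= m1 eqe oner_eq0 /=.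
by rewrite invr1 mule1.
Qed.

Lemma weight_unit_lebesgue s : weight unit_lebesgue cell_digit s = v s.
Proof.
have mD n : measurable_fun setT (cell_digit n) by case: (measurable_cell_word n (fun=> 0)).
pose A : set (measurableTypeR R) := [set x | cell_word (size s) x == s].
have mA : measurable A.
  have [m _] := measurable_cell_word (size s) (fun t => (t == s)%:R).
  have := m measurableT [set 1] (measurable_set1 _); rewrite setTI.
  congr measurable; apply/seteqP; split => x; rewrite /A /=; last by move=> ->.
  by case: eqP => //= _ /esym/eqP; rewrite oner_eq0.
have -> : weight unit_lebesgue cell_digit s = Ex unit_lebesgue (\1_A : measurableTypeR R -> R).
  rewrite /weight; congr Ex; apply/funext => x.
  rewrite word_cell_digit indicE; congr (_%:R); congr nat_of_bool.
  by apply/idP/idP; rewrite inE.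
rewrite Ex_indic// [unit_lebesgue _]unit_lebesgueE//.
rewrite (_ : A `&` I01 = `[left_end s, left_end s + v s[%classic).
  rewrite lebesgue_measure_itv /= lte_fin; case: ltP => h /=; first by rewrite addrAC subrr add0r.
  by apply/eqP; rewrite eq_le v0 /=; move: h; lra.
apply/seteqP; split => x /=; rewrite /I01 /A /= !in_itv /=.
  by move=> [+ x01]; rewrite cell_wordP.
by move=> c; have x01 := cell_unit c; rewrite cell_wordP.
Qed.

End Realisation.

(** * Compactness of models *)

Section BinarySums.
Context (R : realType).
Implicit Types b : nat -> bool.
Local Notation dsum := (dsum R).

Lemma dsumS b n : dsum b n.+1 = dsum b n + (b n)%:R / 2 ^+ n.+1.
Proof. by rewrite /dsum big_ord_recr. Qed.

Lemma eq_dsum b b' n : (forall i, (i < n)%N -> b i = b' i) -> dsum b n = dsum b' n.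
Proof. by move=> e; apply: eq_bigr => i _; rewrite e. Qed.

Lemma dsum_range b n m : (n <= m)%N -> dsum b n <= dsum b m <= dsum b n + 2 ^- n - 2 ^- m.
Proof.
elim: m => [|m IH]; first by rewrite leqn0 => /eqP ->; rewrite addrK !lexx.
rewrite leq_eqVlt => /predU1P[->|]; first by rewrite addrK !lexx.
rewrite ltnS => /IH /andP[h1 h2]; rewrite dsumS.
have t0 : 0 < (2 : R) ^- m.+1 by rewrite invr_gt0 exprn_gt0.
have e : (2 : R) ^- m = 2 ^- m.+1 + 2 ^- m.+1 by rewrite exprS; field; rewrite expf_neq0.
by rewrite e in h2; case: (b m); rewrite ?mul1r ?mul0r; apply/andP; split; lra.
Qed.

Lemma dsum_unit b n : 0 <= dsum b n <= 1.
Proof.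
have /andP[] := dsum_range b (leq0n n).
have -> : dsum b 0 = 0 by rewrite /dsum big_ord0.
rewrite expr0 invr1 add0r => -> h /=.
by apply: le_trans h _; rewrite gerBl invr_ge0 exprn_ge0.
Qed.

(** The number with binary digits [b]. *)
Definition dlim b : R := limn (dsum b).

Lemma nondecreasing_dsum b : nondecreasing_seq (dsum b).
Proof. by move=> n m /(dsum_range b) /andP[]. Qed.

Lemma dsum_cvg b : dsum b @ \oo --> dlim b.
Proof.
apply: nondecreasing_is_cvgn; first exact: nondecreasing_dsum.
by exists 1 => _ [n _ <-]; case/andP: (dsum_unit b n).
Qed.

Lemma dlim_approx b n : `|dlim b - dsum b n| <= 2 ^- n.
Proof.
have h1 : dsum b n <= dlim b.
  apply: (cvgr_to_ge (@dsum_cvg b)); exists n => // m /= nm.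
  by case/andP: (dsum_range b nm).
rewrite ger0_norm ?subr_ge0// lerBlDl.
apply: (cvgr_to_le (@dsum_cvg b)); exists n => // m /= nm.
case/andP: (dsum_range b nm) => _ /le_trans; apply.
by rewrite gerBl invr_ge0 exprn_ge0.
Qed.

Lemma dlim_unit b : 0 <= dlim b <= 1.
Proof.
apply/andP; split; [apply: (cvgr_to_ge (@dsum_cvg b))|apply: (cvgr_to_le (@dsum_cvg b))];
  by apply: nearW => n; case/andP: (dsum_unit b n).
Qed.

End BinarySums.

Section Coding.
Context (R : realType).
Implicit Types (M : model R) (h : bool -> R -> R -> R) (L : R).

Definition observe h M w := h (outcome M w) (expert1 M w) (expert2 M w).
Arguments observe h M w : clear implicits.

Definition lipschitz_unit h L := forall c x x' y y',
  0 <= x <= 1 -> 0 <= x' <= 1 -> 0 <= y <= 1 -> 0 <= y' <= 1 ->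
  `|h c x y - h c x' y'| <= L * (`|x - x'| + `|y - y'|).

(** The sequence [B] codes the outcome by its first digit, and the forecasts of the two experts
by the odd and the other even digits. *)
Definition codes M (B : nat -> mspace M -> bool) :=
  [/\ forall n, measurable_fun setT (B n),
      forall w, outcome M w = B 0%N w,
      forall m w, `|expert1 M w - dsum R (fun i => B i.*2.+1 w) m| <= 2 ^- m &
      forall m w, `|expert2 M w - dsum R (fun i => B i.*2.+2 w) m| <= 2 ^- m].

Lemma codes_exist M : exists B, codes (M := M) B.
Proof.
exists (fun n w => if n is k.+1 then
  (if odd k then digit (expert2 M w) k./2 else digit (expert1 M w) k./2) else outcome M w).
have e1 w : (fun i => if odd i.*2 then digit (expert2 M w) i.*2./2 else digit (expert1 M w)
    i.*2./2) = digit (expert1 M w).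
  by apply/funext => i; rewrite odd_double doubleK.
have e2 w : (fun i => if odd i.*2.+1 then digit (expert2 M w) i.*2.+1./2 else digit (expert1 M
    w) i.*2.+1./2) = digit (expert2 M w).
  by apply/funext => i; rewrite [odd _]/= odd_double [_.+1./2]/= uphalf_double.
split => //.
- case=> [|k]; first exact: measurable_outcome.
  case: (odd k).
    exact: (measurableT_comp (@measurable_digit R _) (@measurable_expert2 R M)).
  exact: (measurableT_comp (@measurable_digit R _) (@measurable_expert1 R M)).
- by move=> m w; rewrite e1; apply/dsum_approx/expert1_unit.
- by move=> m w; rewrite e2; apply/dsum_approx/expert2_unit.
Qed.

Definition decode h m (s : seq bool) : R :=
  h (nth false (rev s) 0) (dsum R (fun i => nth false (rev s) i.*2.+1) m)
    (dsum R (fun i => nth false (rev s) i.*2.+2) m).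

(** A Lipschitz observable depends, up to [2^-m], on the first [2 m + 1] digits, and so on
finitely many weights. *)
Lemma codes_approx M B h L m : codes (M := M) B -> lipschitz_unit h L -> 0 <= L ->
  bmf (observe h M) ->
  `|expect (observe h M) - \sum_(t : (m.*2.+1).-tuple bool) decode h m t * weight (mprob M) B t|
     <= 2 * L * 2 ^- m.
Proof.
move=> [mB B0 B1 B2] lh L0 bh.
have bd := @bmf_word R _ _ _ mB m.*2.+1 (decode h m).
rewrite -Ex_word// /expect -ExB//; apply: Ex_normle => [|w]; first by bmft.
rewrite /decode nth_rev_word// -B0.
rewrite (@eq_dsum _ _ (fun i => B i.*2.+1 w)); last first.
  by move=> i im; rewrite nth_rev_word// ltnS ltn_double.
rewrite (@eq_dsum _ (fun i => nth false _ i.*2.+2) (fun i => B i.*2.+2 w)); last first.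
  by move=> i im; rewrite nth_rev_word// ltnS -doubleS leq_double.
have := lh (outcome M w) (expert1 M w) (dsum R (fun i => B i.*2.+1 w) m)
  (expert2 M w) (dsum R (fun i => B i.*2.+2 w) m)
  (expert1_unit w) (dsum_unit _ _ _) (expert2_unit w) (dsum_unit _ _ _).
move=> /le_trans; apply.
rewrite -mulrA (mulrC 2) -mulrA ler_wpM2l// mulr_natr mulr2n.
by apply: lerD; [exact: B1|exact: B2].
Qed.

(** Take a cluster point of the weights of words along the sequence and realise it by random
digits. The expectation of a Lipschitz observable is, up to a uniform error, a finite
combination of weights, and so passes to the limit. *)
Lemma model_compactness (M_ : nat -> model R) : exists M : model R,
  forall h L (l : R), lipschitz_unit h L -> 0 <= L -> (forall N, bmf (observe h N)) ->
  (fun n => expect (observe h (M_ n))) @ \oo --> l -> expect (observe h M) = l.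
Proof.
pose B n := sval (cid (codes_exist (M_ n))).
have cB n : codes (B n) by exact: (svalP (cid (codes_exist (M_ n)))).
have mB n k : measurable_fun setT (B n k) by case: (cB n).
pose u n s := weight (mprob (M_ n)) (B n) s.
have [v vP] := cluster_weights (fun n s => weight_bounds (mprob (M_ n)) (mB n) s).
have v_ge s : 0 <= v s.
  have := vP [:: s] (fun=> 1) 0; rewrite big_seq1 mul1r; apply.
  by apply: nearW => n; rewrite big_seq1 mul1r;
      case/andP: (weight_bounds (mprob (M_ n)) (mB n) s).
have v_nil : v [::] = 1.
  apply/eqP; rewrite eq_le; apply/andP; split.
    have := vP [:: [::]] (fun=> -1) (-1); rewrite big_seq1 mulN1r lerN2; apply.
    by apply: nearW => n; rewrite big_seq1 weight_nil mulr1.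
  have := vP [:: [::]] (fun=> 1) 1; rewrite big_seq1 mul1r; apply.
  by apply: nearW => n; rewrite big_seq1 weight_nil mulr1.
have v_split s : v s = v (false :: s) + v (true :: s).
  have ne b : (s == b :: s) = false.
    by apply/negP => /eqP /(congr1 size) /= e; have := ltnn (size s); rewrite {2}e ltnS leqnn.
  (* An equality of weights is two opposite inequalities on the words s, 0s and 1s. *)
  pose sgn (k : R) t := if t == s then k else - k.
  have sE k (f : seq bool -> R) : \sum_(t <- [:: s; false :: s; true :: s]) sgn k t * f t =
      k * (f s - (f (false :: s) + f (true :: s))).
    by rewrite !big_cons big_nil /sgn eqxx !(eq_sym _ s) !ne; ring.
  have s0 k : 0 <= k * (v s - (v (false :: s) + v (true :: s))).
    rewrite -sE; apply: vP; apply: nearW => n.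
    by rewrite sE -weight_split ?subrr ?mulr0.
  by have := s0 1; have := s0 (-1); lra.
pose D := cell_digit v.
have mD n : measurable_fun setT (D n) by case: (measurable_cell_word v n (fun=> 0)).
have mlim (k : nat -> nat) : measurable_fun setT (fun w => dlim R (fun i => D (k i) w)).
  apply: (@measurable_fun_cvg _ _ _ _ (fun n w => dsum R (fun i => D (k i) w) n)).
    move=> n; have [] // : bmf (fun w : R => dsum R (fun i => D (k i) w) n).
    by apply: bmf_sum => i; apply: bmfM; [exact: (bmf_bool R (mD (k i)))|exact: bmf_cst].
  by move=> w _; exact: dsum_cvg.
pose M := @Model R _ _ (unit_lebesgue R) (D 0%N)
  (fun w => dlim R (fun i => D i.*2.+1 w)) (fun w => dlim R (fun i => D i.*2.+2 w))
  (mD 0%N) (mlim (fun i => i.*2.+1)) (mlim (fun i => i.*2.+2))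
  (fun w => dlim_unit _ _) (fun w => dlim_unit _ _).
have cM : codes (M := M) D.
  by split => // m w; exact: dlim_approx.
exists M => h L l lh L0 bh hl.
have wv t : weight (mprob M) D t = v t by exact: weight_unit_lebesgue.
have sumE (f g : seq bool -> R) m : \sum_(t : m.-tuple bool) f t * g t =
    \sum_(s <- map val (enum {: m.-tuple bool})) f s * g s.
  by rewrite big_map big_enum.
apply/eqP; rewrite -subr_eq0; apply/eqP.
apply: (@le_pow2_eq0 _ _ (4 * L + 1)) => m.
have t0 : 0 < (2 : R) ^- m by rewrite invr_gt0 exprn_gt0.
have nl : \forall n \near \oo, `|l - expect (observe h (M_ n))| <= 2 ^- m.
  by apply: cvgr_dist_le hl _ t0.
(* The signs of [k] give the lower and the upper estimate at once. *)
have lowS (k : R) (e : k = 1 \/ k = -1) :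
   k * l - (2 * L + 1) * 2 ^- m <= k * \sum_(t : (m.*2.+1).-tuple bool) decode h m t * v t.
  rewrite mulr_sumr; under eq_bigr do rewrite mulrA.
  rewrite (sumE (fun t => k * decode h m t)); apply: vP; apply: filterS nl => n nln.
  rewrite -sumE; under eq_bigr do rewrite -mulrA; rewrite -mulr_sumr.
  have := codes_approx m (cB n) lh L0 (bh (M_ n)); move: nln.
  by rewrite !ler_norml mulrDl mul1r; case: e => ->; lra.
have := lowS 1 (or_introl erefl); have := lowS (-1) (or_intror erefl).
have := codes_approx m cM lh L0 (bh M).
under eq_bigr do rewrite wv.
by rewrite !ler_norml !mulrDl !mul1r => /andP[? ?] ? ?; apply/andP; split; lra.
Qed.

End Coding.

(** * Limits of calibrated models *)

Lemma Ex_dominated (R : realType) d (T : measurableType d) (P : probability T R)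
    (f_ : nat -> T -> R) (f : T -> R) (C : R) :
  (forall n, bmf (f_ n)) -> bmf f -> (forall n w, `|f_ n w| <= C) ->
  (forall w, f_ ^~ w @ \oo --> f w) -> (fun n => Ex P (f_ n)) @ \oo --> Ex P f.
Proof.
move=> bf_ bf fC ff.
have mf_ n : measurable_fun setT (fun w => (f_ n w)%:E).
  by apply/measurable_EFinP; case: (bf_ n).
have mf : measurable_fun setT (fun w => (f w)%:E).
  by apply/measurable_EFinP; case: bf.
have cE : {ae P, forall w, setT w -> (fun n => (f_ n w)%:E) @ \oo --> (f w)%:E}.
  by apply: aeW => w _; apply/fine_cvgP; split; [exact: nearW|exact: ff].
have dE : {ae P, forall w n, setT w -> (`|(f_ n w)%:E| <= (cst C%:E) w)%E}.
  by apply: aeW => w n _ /=; rewrite lee_fin.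
have [_ _] := dominated_convergence measurableT mf_ mf cE
  (finite_measure_integrable_cst P C measurableT) dE.
rewrite EFin_Ex//; under eq_fun do rewrite EFin_Ex//.
by move/fine_cvgP => [_].
Qed.

Section RaysToBorel.
Context (R : realType) d (T : measurableType d) (P : probability T R).
Variables (z f : T -> R).
Hypotheses (bz : bmf z) (bf : bmf f).

(** Rays form a pi-system that generates the Borel sets, and the sets that satisfy the
conclusion form a Dynkin system. *)
Lemma Ex_rays_Borel :
  (forall t, Ex P (fun w => \1_`]t, +oo[%classic (z w) * f w) = 0) -> Ex P f = 0 ->
  forall B : set R, measurable B -> Ex P (fun w => \1_B (z w) * f w) = 0.
Proof.
move=> rays f0.
have mzB (B : set R) : measurable B -> measurable (z @^-1` B).
  by move=> mB; rewrite -[X in measurable X]setTI; apply: bz.1.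
have compE (B : set R) : (fun w => \1_B (z w) * f w) = (fun w => \1_(z @^-1` B) w * f w).
  by apply/funext => w; rewrite !indicE.
move=> B mB.
have mB' : <<s @RGenOInfty.G R >> B.
  have h (F : set (set R)) : F = <<s @RGenOInfty.G R >> -> F B -> <<s @RGenOInfty.G R >> B.
    by move=> ->.
  exact: (h _ (RGenOInfty.measurableE R) mB).
move: B mB' {mB}.
apply: (@dynkin_induction _ R (@RGenOInfty.G R)) => //.
- exact: RGenOInfty.measurableE.
- move=> _ _ [a ->] [b ->]; exists (Num.max a b).
  by apply/seteqP; split => x /=; rewrite !in_itv /= !andbT gt_max => /andP.
- by rewrite -[RHS]f0; congr Ex; apply/funext => w; rewrite indicT mul1r.
- by move=> _ [t ->]; exact: rays.
- move=> S mS PS.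
  rewrite (_ : (fun w => _) = fun w => f w - \1_S (z w) * f w).
    rewrite ExB ?PS ?f0 ?subrr// compE; apply: bmfM => //; apply: bmf_indic; exact: mzB.
  by apply/funext => w; rewrite !indicE in_setC; case: (_ \in _) => /=; ring.
- move=> F mF tF PF.
  have e0 (S : set R) : measurable S ->
     (\int[P]_(w in z @^-1` S) (f w)%:E = (Ex P (fun w => \1_S (z w) * f w))%:E)%E.
    by move=> mS; rewrite EFin_Ex_set ?compE//; exact: mzB.
  have mU : measurable (\bigcup_k F k) by exact: bigcupT_measurable.
  apply/EFin_inj; rewrite -e0// preimage_bigcup integral_bigcup.
  + by rewrite eseries0// => i _ _; rewrite e0// PF.
  + apply/trivIsetP => i j _ _ ij; rewrite -preimage_setI.
    by move/trivIsetP : tF => /(_ i j I I ij) ->; rewrite preimage_set0.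
  + by move=> k; exact: mzB.
  + apply: (integrableS measurableT) => //; last exact: bmf_integrable.
    by apply: bigcupT_measurable => k; exact: mzB.
Qed.

End RaysToBorel.

Section CalibratedLimit.
Context (R : realType).

(** A [k]-Lipschitz approximation of the indicator of the ray above [t]. *)
Definition ramp (k : nat) (t x : R) := clamp (k%:R * (x - t)).

Lemma clampE (x : R) : clamp x = if x <= 0 then 0 else if 1 <= x then 1 else x.
Proof.
rewrite /clamp; case: (leP x 0) => [x0|x0].
  by rewrite (min_r (_ : x <= 1)) ?max_l//; lra.
by case: (leP 1 x) => x1; rewrite max_r ?ltW.
Qed.

Lemma clamp_lip (u v : R) : `|clamp u - clamp v| <= `|u - v|.
Proof.
have := ler_norm (u - v); have := lerNnormlW (lexx `|u - v|).
rewrite !clampE ler_norml; case: (leP u 0) => ?; case: (leP v 0) => ?;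
  try (case: (leP 1 u) => ?); try (case: (leP 1 v) => ?);
  move=> ? ?; apply/andP; split; lra.
Qed.

Lemma ramp_lip k t (x x' : R) : `|ramp k t x - ramp k t x'| <= k%:R * `|x - x'|.
Proof.
rewrite /ramp (le_trans (clamp_lip _ _))//.
rewrite (_ : _ - _ = k%:R * (x - x')); last by ring.
by rewrite normrM normr_nat.
Qed.

Lemma ramp_cvg t (x : R) : (fun k => ramp k t x) @ \oo --> (\1_`]t, +oo[%classic x : R).
Proof.
have [xt|tx] := leP x t.
  rewrite indicE memNset /= ?in_itv /= ?andbT; last by apply/negP; rewrite -leNgt.
  rewrite (_ : (fun k => _) = fun=> 0); first exact: cvg_cst.
  apply/funext => k; rewrite /ramp /clamp.
  have : k%:R * (x - t) <= 0 by rewrite mulr_ge0_le0// subr_le0.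
  by move=> h; rewrite max_l// ge_min h orbT.
rewrite indicE mem_set /= ?in_itv /= ?andbT//.
apply: cvg_near_cst; near=> k; rewrite /ramp /clamp.
have h : 1 <= k%:R * (x - t).
  rewrite -ler_pdivrMr ?subr_gt0// div1r.
  by near: k; exact: nbhs_infty_ger.
by rewrite min_l// max_r.
Unshelve. all: by end_near.
Qed.

Lemma measurable_ramp k t : measurable_fun setT (ramp k t).
Proof.
apply: (measurableT_comp (@measurable_clamp R)); apply: measurable_funM;
    first exact: measurable_cst.
by apply: measurable_funB; [exact: measurable_id|exact: measurable_cst].
Qed.

Definition test (k : nat) (t x c : R) := ramp k t x * (c - x).

Lemma test_lip k t (c x x' : R) : 0 <= c <= 1 -> 0 <= x <= 1 -> 0 <= x' <= 1 ->
  `|test k t x c - test k t x' c| <= (k%:R + 1) * `|x - x'|.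
Proof.
move=> c01 x01 x'01; rewrite /test.
rewrite (_ : _ - _ = (ramp k t x - ramp k t x') * (c - x) + ramp k t x' * (x' - x)); last by ring.
rewrite (le_trans (ler_normD _ _))// !normrM mulrDl mul1r (distrC x' x) lerD//.
  rewrite -[leRHS]mulr1 ler_pM// ?ramp_lip// ler_norml.
  by apply/andP; split; lra.
by rewrite ler_piMl// ger0_norm; case/andP: (clamp_unit (k%:R * (x' - t))).
Qed.

Lemma objective_lip (al be p : R) : 0 <= p <= 1 ->
  lipschitz_unit (fun _ x y => objective al be p (x, y)) (2 * `|al| + 4 * `|be|).
Proof.
move=> p01 _ x x' y y' hx hx' hy hy'; rewrite /objective /=.
rewrite (_ : _ - _ = al * (((x - y) + (x' - y')) * ((x - x') - (y - y')))
  + be * (((x + y - 2 * p) + (x' + y' - 2 * p)) * ((x - x') + (y - y')))); last by ring.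
rewrite (le_trans (ler_normD _ _))// !normrM [leRHS]mulrDl lerD//.
  rewrite (mulrC 2) -mulrA ler_wpM2l// ler_pM// ?ler_normB//.
  by rewrite ler_norml; apply/andP; split; lra.
rewrite (mulrC 4) -mulrA ler_wpM2l// ler_pM// ?ler_normD//.
by rewrite ler_norml; apply/andP; split; lra.
Qed.

(** The tests by ramps are Lipschitz, hence pass to the limit model; there, letting the slope go
to infinity gives calibration on rays, and so on Borel sets. *)
Lemma calibrated_limit (p al be V : R) (M_ : nat -> model R) : 0 <= p <= 1 ->
  (forall n, calibrated p (M_ n)) ->
  (fun n => value p (M_ n) al be) @ \oo --> V ->
  exists2 M, calibrated p M & value p M al be = V.
Proof.
move=> p01 calM lim; have [M MP] := model_compactness M_.
have bc (N : model R) := bmf_outcomeR N; have b1 (N : model R) := bmf_expert1 N;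
    have b2 (N : model R) := bmf_expert2 N.
have bool01 (c : bool) : 0 <= (c%:R : R) <= 1 by case: c; rewrite ?lexx ?ler01.
have mean : expect (outcomeR M) = p.
  have := MP (fun c _ _ => c%:R) 0 p; apply => //.
  - by move=> c x x' y y' *; rewrite subrr normr0 mul0r.
  - rewrite (_ : (fun n => _) = fun=> p); first exact: cvg_cst.
    by apply/funext => n; case: (calM n).
have btest (N : model R) k t (z : mspace N -> R) : bmf z -> bmf (fun w => ramp k t (z w)).
  move=> bz; apply: bmf_unit => [|w]; last exact: clamp_unit.
  exact: (measurableT_comp (measurable_ramp k t) bz.1).
have pull (N : model R) (z : mspace N -> R) k t : bmf z ->
    (forall B, measurable B -> expect (fun w => \1_B (z w) * (outcomeR N w - z w)) = 0) ->
    expect (fun w => test k t (z w) (outcomeR N w)) = 0.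
  move=> bz cz; have [mz _] := bz.
  apply: (@Ex_pullout _ _ _ (mprob N) z (fun w => outcomeR N w - z w) (ramp k t)) => //.
  - by have bcN := bc N; bmft.
  - exact: measurable_ramp.
  - by move=> w; exact: clamp_unit.
have test1 k t : expect (fun w => test k t (expert1 M w) (outcomeR M w)) = 0.
  have := MP (fun c x _ => test k t x c%:R) (k%:R + 1) 0; apply.
  - move=> c x x' y y' hx hx' hy hy'; apply: le_trans (test_lip k t (bool01 c) hx hx') _.
    by rewrite ler_wpM2l// ?lerDl// addr_ge0.
  - by rewrite addr_ge0.
  - by move=> N; have := btest N k t _ (b1 N); have := bc N; have := b1 N => ? ? ?;
      rewrite /observe /test; bmft.
  - rewrite (_ : (fun n => _) = fun=> 0); first exact: cvg_cst.
    by apply/funext => n; case: (calM n) => _ c1 _; exact: pull.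
have test2 k t : expect (fun w => test k t (expert2 M w) (outcomeR M w)) = 0.
  have := MP (fun c _ x => test k t x c%:R) (k%:R + 1) 0; apply.
  - move=> c x x' y y' hx hx' hy hy'; apply: le_trans (test_lip k t (bool01 c) hy hy') _.
    by rewrite ler_wpM2l// ?lerDr// addr_ge0.
  - by rewrite addr_ge0.
  - by move=> N; have := btest N k t _ (b2 N); have := bc N; have := b2 N => ? ? ?;
      rewrite /observe /test; bmft.
  - rewrite (_ : (fun n => _) = fun=> 0); first exact: cvg_cst.
    by apply/funext => n; case: (calM n) => _ _ c2; exact: pull.
have borel (z : mspace M -> R) : bmf z -> (forall w, 0 <= z w <= 1) ->
    (forall k t, expect (fun w => test k t (z w) (outcomeR M w)) = 0) ->
    forall B, measurable B -> expect (fun w => \1_B (z w) * (outcomeR M w - z w)) = 0.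
  move=> bz z01 tz.
  have bcM := bc M; have bcz : bmf (fun w => outcomeR M w - z w) by bmft.
  have rays t : expect (fun w => \1_`]t, +oo[%classic (z w) * (outcomeR M w - z w)) = 0.
    have b1z : bmf (fun w => \1_`]t, +oo[%classic (z w) : R).
      have -> : (fun w => \1_`]t, +oo[%classic (z w) : R) = \1_(z @^-1` `]t, +oo[%classic).
        by apply/funext => w; rewrite !indicE.
      by apply: bmf_indic; rewrite -[X in measurable X]setTI; apply: bz.1.
    have bt k : bmf (fun w => test k t (z w) (outcomeR M w)).
      by have := btest M k t z bz => ?; rewrite /test; bmft.
    have dom : (fun k => Ex (mprob M) (fun w => test k t (z w) (outcomeR M w))) @ \oo -->
        Ex (mprob M) (fun w => \1_`]t, +oo[%classic (z w) * (outcomeR M w - z w)).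
      apply: (@Ex_dominated _ _ _ _ _ _ 1) => //; first by bmft.
        move=> k w; rewrite /test normrM mulr_ile1//.
          by rewrite ger0_norm; case/andP: (clamp_unit (k%:R * (z w - t))).
        by rewrite ler_norml; have := z01 w; have := bool01 (outcome M w); rewrite /outcomeR; lra.
      by move=> w; apply: cvgMr_tmp; exact: ramp_cvg.
    apply: (cvg_unique _ dom) => //.
    rewrite (_ : (fun k => _) = fun=> 0); first exact: cvg_cst.
    by apply/funext => k; exact: tz.
  apply: Ex_rays_Borel => //.
  have := rays (-1); rewrite /expect; congr (_ = _); congr Ex; apply/funext => w.
  rewrite indicE mem_set ?mul1r//= in_itv /= andbT.
  by have := z01 w; lra.
exists M; first split => //.
- exact: borel (b1 M) (@expert1_unit R M) test1.
- exact: borel (b2 M) (@expert2_unit R M) test2.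
- apply: (MP _ _ V (objective_lip al be p01)).
  + by rewrite addr_ge0 ?mulr_ge0.
  + by move=> N; exact: bmf_objective.
  + exact: lim.
Qed.
End CalibratedLimit.

(** * Models on finitely many points *)

Section FiniteProbability.
Context (R : realType) (m : nat) (r : nat -> R).
Hypotheses (r0 : forall i, 0 <= r i) (r1 : \sum_(i < m) r i = 1).

Definition weighted_diracs (d : measure_display) (T : measurableType d) (z : nat -> T) :
  {measure set T -> \bar R} := msum (fun i => mscale (NngNum (r0 i)) (dirac (z i))) m.

Lemma weighted_diracsE d (T : measurableType d) (z : nat -> T) A :
  weighted_diracs z A = (\sum_(i < m) r i * \1_A (z i))%:E.
Proof.
rewrite /weighted_diracs /= /msum -sumEFin; apply: eq_bigr => i _.
by [].
Qed.

Definition finite_prob (d : measure_display) (T : measurableType d) (z : nat -> T) :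
    probability T R :=
  mnormalize (weighted_diracs z) (dirac (z 0%N)).

Lemma finite_probE d (T : measurableType d) (z : nat -> T) A :
  finite_prob z A = (\sum_(i < m) r i * \1_A (z i))%:E.
Proof.
have e1 : weighted_diracs z setT = 1%E.
  rewrite weighted_diracsE -[1%E]/(1%:E) -r1; congr EFin; apply: eq_bigr => i _.
  by rewrite indicT mulr1.
rewrite /finite_prob /= /mnormalize /= e1 eqe oner_eq0 /= invr1 mule1.
exact: weighted_diracsE.
Qed.

(** Almost surely [f] agrees with a finite combination of indicators of points. *)
Lemma Ex_finite (f : nat -> R) : bmf f ->
  Ex (finite_prob id) f = \sum_(i < m) r i * f i.
Proof.
move=> bf; pose g (w : nat) := \sum_(i < m) f i * \1_[set (i : nat)] w.
have b1 (i : 'I_m) : bmf (fun w : nat => f i * \1_[set (i : nat)] w).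
  by apply: bmfM; [exact: bmf_cst|exact: bmf_indic].
rewrite (@Ex_ae _ _ _ _ f g) //; last 2 first.
- exact: bmf_sum.
- exists [set w : nat | (m <= w)%N]; split => //.
    rewrite [finite_prob _ _]finite_probE big1// => i _.
    by rewrite indicE memNset ?mulr0//= leqNgt ltn_ord.
  move=> w /= h; rewrite leqNgt; apply/negP => wm; apply: h.
  rewrite /g (bigD1 (Ordinal wm))//= big1 => [|i /negP iw]; last first.
    by rewrite indicE memNset ?mulr0//= => e; apply: iw; apply/eqP/val_inj.
  by rewrite indicE mem_set// mulr1 addr0.
rewrite Ex_sum//; apply: eq_bigr => i _.
rewrite ExZ ?Ex_indic//; last exact: bmf_indic.
rewrite mulrC [finite_prob _ _]finite_probE /= (bigD1 i)//= big1 => [|j ji].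
  by rewrite indicE mem_set// mulr1 addr0.
rewrite indicE memNset ?mulr0//= => e.
by move/eqP: ji; apply; exact: val_inj.
Qed.

End FiniteProbability.

Section FiniteModel.
Context (R : realType) (m : nat) (r : nat -> R).
Hypotheses (r0 : forall i, 0 <= r i) (r1 : \sum_(i < m) r i = 1).
Variables (o : nat -> bool) (x y : nat -> R).
Hypotheses (x01 : forall i, 0 <= x i <= 1) (y01 : forall i, 0 <= y i <= 1).

Definition finite_model := @Model R _ nat (finite_prob m r0 (@id nat)) o x y
  (fun _ _ _ => I) (fun _ _ _ => I) (fun _ _ _ => I) x01 y01.

Lemma finite_model_law (mu : plane_prob R) A : has_law finite_model mu -> measurable A ->
  mu A = (\sum_(i < m) r i * \1_A (x i, y i))%:E.
Proof.
by move=> law mA; have -> := law _ mA; exact: (finite_probE r0 r1).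
Qed.

Lemma finite_model_calibrated :
  (forall g : R -> R, \sum_(i < m) r i * (g (x i) * ((o i)%:R - x i)) = 0) ->
  (forall g : R -> R, \sum_(i < m) r i * (g (y i) * ((o i)%:R - y i)) = 0) ->
  calibrated (\sum_(i < m) r i * (o i)%:R) finite_model.
Proof.
move=> cx cy; have bX := bmf_outcomeR finite_model.
have b1 := bmf_expert1 finite_model; have b2 := bmf_expert2 finite_model.
split; first exact: (Ex_finite r0 r1).
- move=> B mB; rewrite /expect (Ex_finite r0 r1); first exact: (cx \1_B).
  by apply: bmfM; [exact: (bmf_indic_comp b1 mB)|bmft].
- move=> B mB; rewrite /expect (Ex_finite r0 r1); first exact: (cy \1_B).
  by apply: bmfM; [exact: (bmf_indic_comp b2 mB)|bmft].
Qed.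

End FiniteModel.

(** * Ladders and supports *)

Lemma sorted_map_iota (T : Type) (e : rel T) (f : nat -> T) k n :
  (forall i, e (f i) (f i.+1)) -> sorted e [seq f i | i <- iota k n].
Proof.
move=> ef; case: n => //= n.
by elim: n k => //= n IH k; rewrite ef; exact: IH.
Qed.

Lemma count_le2 (P : pred nat) (s : seq nat) a b : uniq s ->
  (forall i, P i -> i = a \/ i = b) -> (count P s <= 2)%N.
Proof.
move=> us Pab; rewrite -size_filter; apply: (@uniq_leq_size _ _ [:: a; b]).
  exact: filter_uniq.
move=> i; rewrite mem_filter !inE => /andP[/Pab[->|->] _]; rewrite eqxx ?orbT//.
Qed.

Section Ladder.
Context (R : realType) (del x0 y0 : R).
Hypothesis del0 : del != 0.

(** Along a ladder the abscissa changes at odd steps and the ordinate at even steps, by the same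
amount in opposite directions; so the sum of the coordinates takes two values only. *)
Definition rung (i : nat) : R * R := (x0 - del * (uphalf i)%:R, y0 + del * (i./2)%:R).

Let cancel_nat (a b : nat) : del * a%:R = del * b%:R -> a = b.
Proof. by move/(mulfI del0)/eqP; rewrite eqr_nat => /eqP. Qed.

Lemma rung_fst i j : (rung i).1 = (rung j).1 -> uphalf i = uphalf j.
Proof. by move=> /= e; apply: cancel_nat; lra. Qed.

Lemma rung_snd i j : (rung i).2 = (rung j).2 -> i./2 = j./2.
Proof. by move=> /= e; apply: cancel_nat; lra. Qed.

(** The two halves of an index determine it. *)
Lemma rung_inj : injective rung.
Proof.
move=> i j e; have := rung_fst (congr1 fst e); have := rung_snd (congr1 snd e).
move=> h u; rewrite -[LHS]odd_double_half -[RHS]odd_double_half.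
by rewrite -!addnn !addnA -!uphalf_half u h.
Qed.

Lemma rung_step i : ((rung i).1 == (rung i.+1).1) || ((rung i).2 == (rung i.+1).2).
Proof.
rewrite /rung /= uphalf_half.
by case: (odd i) => /=; rewrite ?add1n ?add0n eqxx ?orbT.
Qed.

(** An abscissa is shared only by the rungs with indices [2 u - 1] and [2 u], and an ordinate
only by the rungs with indices [2 u] and [2 u + 1]. *)
Lemma rungs_ladder k n : is_ladder [seq rung i | i <- iota k n].
Proof.
have ui : uniq (iota k n) := iota_uniq k n.
have up i : (uphalf i)%:R <= (uphalf i.+1)%:R :> R.
  by rewrite ler_nat uphalf_half /=; case: (odd i) => /=; rewrite ?add1n ?add0n ?leqnn.
have hf i : (i./2)%:R <= (i.+1./2)%:R :> R.
  by rewrite ler_nat /= uphalf_half leq_addl.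
split.
- by rewrite (map_inj_uniq rung_inj).
- rewrite -!map_comp; case: (lerP 0 del) => d0; split.
  + by right; apply: sorted_map_iota => i /=; rewrite lerD2l lerN2 ler_wpM2l.
  + by left; apply: sorted_map_iota => i /=; rewrite lerD2l ler_wpM2l.
  + by left; apply: sorted_map_iota => i /=; rewrite lerD2l lerN2 ler_wnM2l// ltW.
  + by right; apply: sorted_map_iota => i /=; rewrite lerD2l ler_wnM2l// ltW.
- by apply: sorted_map_iota => i; exact: rung_step.
- move=> c; rewrite !count_map; split.
  + have [/hasP[j _ /eqP jc]|/hasPn no] := boolP (has (preim rung (fun z => z.1 == c)) (iota k
      n)); last first.
      by rewrite (@eq_in_count _ _ pred0) ?count_pred0// => i /no /negbTE.
    apply: (@count_le2 _ _ (uphalf j).*2 (uphalf j).*2.-1) => // i /eqP ic.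
    have -> : uphalf j = uphalf i by apply: rung_fst; rewrite jc ic.
    rewrite uphalf_half; have := odd_double_half i; case: (odd i) => /= e.
      by right; rewrite doubleD /= -[LHS]e.
    by left; rewrite add0n -[LHS]e.
  + have [/hasP[j _ /eqP jc]|/hasPn no] := boolP (has (preim rung (fun z => z.2 == c)) (iota k
      n)); last first.
      by rewrite (@eq_in_count _ _ pred0) ?count_pred0// => i /no /negbTE.
    apply: (@count_le2 _ _ (j./2).*2 (j./2).*2.+1) => // i /eqP ic.
    have -> : j./2 = i./2 by apply: rung_snd; rewrite jc ic.
    have := odd_double_half i; case: (odd i) => /= e.
      by right; rewrite -[LHS]e.
    by left; rewrite -[LHS]e.
Qed.

End Ladder.

Section FiniteSupport.
Context (R : realType).

(** The plane has a countable base: an open set is the union of the squares with rational centre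
and inverse integer radius that it contains. *)
Lemma open_measurable_plane (U : set (R * R)) : open U -> measurable U.
Proof.
move=> oU.
pose box (q1 q2 : rat) (n : nat) : set (R * R) :=
  ball (ratr q1 : R) n.+1%:R^-1 `*` ball (ratr q2 : R) n.+1%:R^-1.
pose good q1 q2 n := if pselect (box q1 q2 n `<=` U) then box q1 q2 n else set0.
rewrite (_ : U = \bigcup_q1 \bigcup_q2 \bigcup_n good q1 q2 n).
  have mgood q1 q2 n : measurable (good q1 q2 n).
    have mb : measurable (box q1 q2 n) by apply: measurableX; exact: measurable_ball.
    by rewrite /good; case: pselect => ? //; exact: measurable0.
  have m1 q1 q2 : measurable (\bigcup_n good q1 q2 n) by exact: bigcupT_measurable.
  have m2 q1 : measurable (\bigcup_q2 \bigcup_n good q1 q2 n) by exact: bigcupT_measurable_rat.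
  exact: bigcupT_measurable_rat.
apply/seteqP; split => [u Uu|u [q1 _ [q2 _ [n _]]]]; last first.
  by rewrite /good; case: pselect => // sub /sub.
have /nbhs_ballP[e /= e0 eU] : nbhs u U by exact: open_nbhs_nbhs.
have [n ne] : exists n, n.+1%:R^-1 < e / 2.
  exists (Num.bound (e / 2)^-1); rewrite invf_plt ?posrE ?divr_gt0//.
  by rewrite (lt_le_trans (archi_boundP _)) ?ler_nat// invr_ge0 divr_ge0// ltW.
have rat_near (t : R) : exists q : rat, ball (ratr q : R) n.+1%:R^-1 t.
  have lt : t - n.+1%:R^-1 < t + n.+1%:R^-1 by rewrite ltrD2l gtrN// invr_gt0.
  have [q] := rat_in_itvoo lt; rewrite in_itv /= => /andP[h1 h2].
  by exists q; rewrite -ball_normE /ball_ /= ltr_distl h1 h2.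
have [q1 b1] := rat_near u.1; have [q2 b2] := rat_near u.2.
exists q1 => //; exists q2 => //; exists n => //.
rewrite /good; case: pselect => // nsub; apply: nsub => -[z1 z2] [/= c1 c2].
have ball_e (k s t d : R) : d < e / 2 -> ball k d s -> ball k d t -> ball s e t.
  rewrite -!ball_normE /ball_ /= !ltr_distl => ? /andP[? ?] /andP[? ?].
  by apply/andP; split; lra.
by apply: eU; split => /=; [exact: ball_e ne b1 c1|exact: ball_e ne b2 c2].
Qed.

(** The finite set of the points is closed, so its complement is an open null set, while every
neighbourhood of a point carries the mass of that point. *)
Lemma finite_support (mu : plane_prob R) (m : nat) (r : nat -> R) (z : nat -> R * R) :
  (forall i, (i < m)%N -> 0 < r i) ->
  (forall A, measurable A -> mu A = (\sum_(i < m) r i * \1_A (z i))%:E) ->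
  support_of mu = [set` [seq z i | i <- iota 0 m]].
Proof.
move=> r0 muE.
apply/seteqP; split => u /=.
- move=> su; apply: contrapT => nu.
  pose U := ~` [set` [seq z i | i <- iota 0 m]].
  have oU : open U.
    apply: closed_openC.
    have acc := hausdorff_accessible (@norm_hausdorff R (R * R)%type).
    exact: (accessible_finite_set_closed.1 acc _ (finite_seq _)).
  have := su U oU nu; rewrite muE; last exact: open_measurable_plane.
  rewrite big1 ?ltxx// => i _; rewrite indicE memNset ?mulr0// /U /=.
  by apply; apply: map_f; rewrite mem_iota /=.
- move=> /mapP[i]; rewrite mem_iota /= add0n => im -> U oU Ui.
  rewrite muE; last exact: open_measurable_plane.
  rewrite lte_fin (bigD1 (Ordinal im))//= indicE mem_set// mulr1.
  apply: ltr_pwDl; first exact: r0.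
  by apply: sumr_ge0 => j _; apply: mulr_ge0 => //; apply: ltW; exact: r0.
Qed.

End FiniteSupport.

(** * Masses along a chain *)

Section Chain.
Context (R : realType) (del x0 y0 : R) (c : bool) (m : nat).
Hypothesis m0 : (0 < m)%N.

Definition label i : bool := c (+) odd i.
(** The [i]-th rung is an edge that joins the values [vertex i] and [vertex i.+1] of the two
experts; even vertices are values of the first expert and odd ones of the second. *)
Definition vertex k : R := if odd k then y0 + del * (k./2)%:R else x0 - del * (k./2)%:R.

Hypotheses (first_vertex : vertex 0 = (label 0)%:R)
  (last_vertex : vertex m = (label m.-1)%:R)
  (inner_vertex : forall k, (0 < k < m)%N -> 0 < vertex k < 1).

Local Notation z := (rung del x0 y0).

Lemma rung_vertex i : z i = if odd i then (vertex i.+1, vertex i) else (vertex i, vertex i.+1).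
Proof.
rewrite /rung /vertex /= uphalf_half.
by case: (odd i) => /=; rewrite ?add1n ?add0n.
Qed.

Local Opaque rung.

(** At an inner vertex with value [t] the masses of the two incident edges must be in the ratio
[t : 1 - t], the edge with outcome 1 first. *)
Definition ratio k : R :=
  if label k then (1 - vertex k.+1) / vertex k.+1 else vertex k.+1 / (1 - vertex k.+1).

Fixpoint mass k : R := if k is j.+1 then mass j * ratio j else 1.

Lemma mass_gt0 k : (k < m)%N -> 0 < mass k.
Proof.
elim: k => [_|k IH km]; first exact: ltr01.
have /andP[h0 h1] := @inner_vertex k.+1 km.
apply: mulr_gt0; first by apply: IH; exact: ltnW.
by rewrite /ratio; case: (label k); rewrite divr_gt0 ?subr_gt0.
Qed.

Lemma mass_balance k : (k.+1 < m)%N ->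
  mass k * ((label k)%:R - vertex k.+1) + mass k.+1 * ((label k.+1)%:R - vertex k.+1) = 0.
Proof.
move=> km; have /andP[h0 h1] := @inner_vertex k.+1 km.
have l1 : label k.+1 = ~~ label k by rewrite /label /= addbN.
rewrite l1 [mass k.+1]/= /ratio; case: (label k) => /=.
  by field; rewrite gt_eqF.
by field; rewrite gt_eqF// subr_gt0.
Qed.

(** At an inner vertex the two incident edges cancel by [mass_balance]. What is left of the
partial sum is the term of the last vertex, for the expert who owns it. *)
Lemma mass_telescope (g : R -> R) k : (k < m)%N ->
  \sum_(i < k.+1) mass i * (g (z i).1 * ((label i)%:R - (z i).1)) =
    (if odd k then mass k * (g (vertex k.+1) * ((label k)%:R - vertex k.+1)) else 0) /\
  \sum_(i < k.+1) mass i * (g (z i).2 * ((label i)%:R - (z i).2)) =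
    (if odd k then 0 else mass k * (g (vertex k.+1) * ((label k)%:R - vertex k.+1))).
Proof.
elim: k => [|k IH] km.
  rewrite !big_ord1 /= rung_vertex /=.
  by rewrite first_vertex subrr !mulr0.
have [e1 e2] := IH (ltnW km).
rewrite big_ord_recr e1 /= [in X in _ /\ X]big_ord_recr e2 /= rung_vertex /=.
have b := mass_balance km.
have bg : mass k * (g (vertex k.+1) * ((label k)%:R - vertex k.+1)) +
    mass k * ratio k * (g (vertex k.+1) * ((label k.+1)%:R - vertex k.+1)) = 0.
  by rewrite -[RHS](mulr0 (g (vertex k.+1))) -b /=; ring.
by case: (odd k) => /=; rewrite ?add0r; split.
Qed.

(** At both end vertices the forecast is the outcome of the sole incident edge, so that the
boundary terms of the telescoping vanish. *)
Lemma mass_calibrated (g : R -> R) :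
  \sum_(i < m) mass i * (g (z i).1 * ((label i)%:R - (z i).1)) = 0 /\
  \sum_(i < m) mass i * (g (z i).2 * ((label i)%:R - (z i).2)) = 0.
Proof.
have := @mass_telescope g m.-1; rewrite prednK// => /(_ (leqnn _)).
by rewrite last_vertex subrr !mulr0 if_same.
Qed.

Lemma vertex_unit k : (k <= m)%N -> 0 <= vertex k <= 1.
Proof.
have b (e : bool) : 0 <= (e%:R : R) <= 1 by case: e; rewrite ?lexx ?ler01.
rewrite leq_eqVlt => /predU1P[->|km]; first by rewrite last_vertex.
case: k km => [|k] km; first by rewrite first_vertex.
by have /andP[/ltW -> /ltW ->] := @inner_vertex k.+1 km.
Qed.

Lemma rung_unit i : (i < m)%N -> 0 <= (z i).1 <= 1 /\ 0 <= (z i).2 <= 1.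
Proof.
by move=> im; rewrite rung_vertex; case: (odd i); split; apply: vertex_unit => //; exact: ltnW.
Qed.

Lemma mass_sum_gt0 : 0 < \sum_(i < m) mass i.
Proof.
rewrite (bigD1 (Ordinal m0))//= ltr_pwDl//.
by apply: sumr_ge0 => i _; apply/ltW/mass_gt0.
Qed.

Definition chain_weight i : R := if (i < m)%N then mass i / \sum_(j < m) mass j else 0.

Lemma chain_weight_gt0 i : (i < m)%N -> 0 < chain_weight i.
Proof. by move=> im; rewrite /chain_weight im divr_gt0 ?mass_gt0 ?mass_sum_gt0. Qed.

Lemma chain_weight_ge0 i : 0 <= chain_weight i.
Proof.
have [im|mi] := ltnP i m; first exact/ltW/chain_weight_gt0.
by rewrite /chain_weight ltnNge mi.
Qed.

Lemma chain_sumE (f : nat -> R) :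
  \sum_(i < m) chain_weight i * f i = (\sum_(i < m) mass i)^-1 * \sum_(i < m) mass i * f i.
Proof.
rewrite mulr_sumr; apply: eq_bigr => i _.
by rewrite /chain_weight ltn_ord mulrAC [LHS]mulrC.
Qed.

Lemma chain_weight_sum : \sum_(i < m) chain_weight i = 1.
Proof.
transitivity (\sum_(i < m) chain_weight i * 1); first by apply: eq_bigr => i _; rewrite mulr1.
rewrite (chain_sumE (fun=> 1)) /=; under [X in _ * X]eq_bigr do rewrite mulr1.
by rewrite mulVf// gt_eqF// mass_sum_gt0.
Qed.

Definition chain_model := finite_model m chain_weight_ge0 label
  (fun i => clamp_unit (z i).1) (fun i => clamp_unit (z i).2).

Lemma chain_model_calibrated :
  calibrated (\sum_(i < m) chain_weight i * (label i)%:R) chain_model.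
Proof.
apply: finite_model_calibrated; first exact: chain_weight_sum.
- move=> g; rewrite (chain_sumE (fun i => g (clamp (z i).1) * ((label i)%:R - clamp (z i).1))).
  rewrite [X in _ * X](eq_bigr (fun i : 'I_m => mass i * (g (z i).1 * ((label i)%:R - (z i).1)))).
    by rewrite (mass_calibrated g).1 mulr0.
  by move=> i _; have [h1 h2] := rung_unit (ltn_ord i); rewrite clampK.
- move=> g; rewrite (chain_sumE (fun i => g (clamp (z i).2) * ((label i)%:R - clamp (z i).2))).
  rewrite [X in _ * X](eq_bigr (fun i : 'I_m => mass i * (g (z i).2 * ((label i)%:R - (z i).2)))).
    by rewrite (mass_calibrated g).2 mulr0.
  by move=> i _; have [h1 h2] := rung_unit (ltn_ord i); rewrite clampK.
Qed.

Lemma chain_law (mu : plane_prob R) A : has_law chain_model mu -> measurable A ->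
  mu A = (\sum_(i < m) chain_weight i * \1_A (z i))%:E.
Proof.
move=> law mA; rewrite (finite_model_law chain_weight_sum law mA); congr EFin.
apply: eq_bigr => i _; have [h1 h2] := rung_unit (ltn_ord i).
by rewrite !clampK//; case: (z i).
Qed.

Section Optimal.
Variables (al be p : R).
Let lam := al / (al - be).
Hypotheses (ab : al - be != 0) (lam2 : lam != 2)
  (sumE : forall i, (z i).1 + (z i).2 = (2 - lam) * p + lam * (label i)%:R).

(** Twice the mean of the outcome is the mean of the sum of the forecasts, which is [(2 - lam) p
+ lam q]; this determines [q] because [lam] is not 2. *)
Lemma chain_mean : \sum_(i < m) chain_weight i * (label i)%:R = p.
Proof.
have h1 : \sum_(i < m) chain_weight i * ((label i)%:R - (z i).1) = 0.
  rewrite (chain_sumE (fun i => (label i)%:R - (z i).1)).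
  have := (mass_calibrated (fun=> 1)).1; under eq_bigr do rewrite mul1r.
  by move=> ->; rewrite mulr0.
have h2 : \sum_(i < m) chain_weight i * ((label i)%:R - (z i).2) = 0.
  rewrite (chain_sumE (fun i => (label i)%:R - (z i).2)).
  have := (mass_calibrated (fun=> 1)).2; under eq_bigr do rewrite mul1r.
  by move=> ->; rewrite mulr0.
set q := \sum_(i < m) _.
have e : (2 - lam) * q = (2 - lam) * p.
  have : \sum_(i < m) chain_weight i * ((label i)%:R - (z i).1) +
     \sum_(i < m) chain_weight i * ((label i)%:R - (z i).2) =
     (2 - lam) * q - (2 - lam) * p * \sum_(i < m) chain_weight i.
    rewrite /q !mulr_sumr -big_split -sumrB /=; apply: eq_bigr => i _.
    have s := sumE i; rewrite -mulrDr.
    rewrite (_ : _ - _ + _ = 2 * (label i)%:R - ((z i).1 + (z i).2)); last by ring.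
    by rewrite s; ring.
  by rewrite h1 h2 chain_weight_sum; lra.
by apply: (mulfI _ e); rewrite subr_eq0 eq_sym.
Qed.

(** On the chain the sum of the forecasts is the affine function of the outcome for which the
square in [value_deficit] vanishes. *)
Lemma chain_value : value p chain_model al be = p * (1 - p) * (al ^+ 2 / (al - be)).
Proof.
have cal := chain_model_calibrated; rewrite chain_mean in cal.
have := value_deficit cal ab; rewrite -/lam => <-.
rewrite [X in _ + _ * X](_ : _ = 0) ?mulr0 ?addr0//.
have b1 := bmf_expert1 chain_model; have b2 := bmf_expert2 chain_model.
have bc := bmf_outcomeR chain_model.
rewrite /expect (Ex_finite chain_weight_ge0 chain_weight_sum); last by bmft.
rewrite big1// => i _; have [h1 h2] := rung_unit (ltn_ord i).
by rewrite /= !clampK// sumE /outcomeR /=; ring.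
Qed.

End Optimal.
End Chain.

(** * Maximisers and the two extreme models *)

Section Maximum.
Context (R : realType) (p al be : R).
Hypothesis p01 : 0 <= p <= 1.

Lemma value_bound (M : model R) : `|value p M al be| <= `|al| + 4 * `|be|.
Proof.
apply: Ex_normle => [|w]; first exact: bmf_objective.
have h1 := expert1_unit w; have h2 := expert2_unit w; have h3 := p01.
have sq (t k : R) : 0 <= k -> `|t| <= k -> `|t ^+ 2| <= k ^+ 2.
  by move=> k0 tk; rewrite normrX lerXn2r// nnegrE.
rewrite /objective /=; set s := expert1 M w - _; set t := expert1 M w + _ - _.
have s1 : `|s ^+ 2| <= 1 ^+ 2 by apply: sq => //; rewrite ler_norml /s; lra.
have t2 : `|t ^+ 2| <= 2 ^+ 2 by apply: sq => //; rewrite ler_norml /t; lra.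
rewrite expr1n in s1; rewrite (_ : 2 ^+ 2 = 4) in t2; last by ring.
apply: le_trans (ler_normD _ _) _; apply: lerD; rewrite normrM.
  by rewrite ler_piMr.
by rewrite mulrC ler_wpM2r.
Qed.

(** A maximising sequence of models has a limit model by [calibrated_limit]. *)
Lemma maximal_model : (exists M : model R, calibrated p M) ->
  exists2 M : model R, calibrated p M &
    forall N, calibrated p N -> value p N al be <= value p M al be.
Proof.
move=> [M0 cal0].
pose E := [set v : R | exists2 N : model R, calibrated p N & v = value p N al be].
have supE : has_sup E.
  split; first by exists (value p M0 al be); exists M0.
  exists (`|al| + 4 * `|be|) => _ [N _ ->].
  by apply: le_trans (value_bound N); exact: ler_norm.
have adh n : exists N : model R, calibrated p N /\ sup E - n.+1%:R^-1 < value p N al be.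
  have [|_ [N calN ->] lt] := @sup_adherent _ E n.+1%:R^-1 _ supE; first by rewrite invr_gt0.
  by exists N.
have [N_ NP] := choice adh.
have lim : (fun n => value p (N_ n) al be) @ \oo --> sup E.
  apply: (@squeeze_cvgr _ _ _ _ (fun n => sup E - n.+1%:R^-1) (fun=> sup E)).
  - apply: nearW => n; have [calN lt] := NP n; rewrite ltW//=.
    by apply: ub_le_sup; [exact: supE.2|exists (N_ n)].
  - rewrite -[X in _ --> X]subr0; apply: cvgB; first exact: cvg_cst.
    exact: cvg_harmonic.
  - exact: cvg_cst.
have [M calM vM] := calibrated_limit p01 (fun n => (NP n).1) lim.
exists M => // N calN; rewrite vM.
by apply: ub_le_sup; [exact: supE.2|exists N].
Qed.

Lemma model_is_max (M : model R) : calibrated p M ->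
  (forall N, calibrated p N -> value p N al be <= value p M al be) ->
  is_max_integral al be p (value p M al be).
Proof.
move=> calM maxM; split.
  have [mu law] := has_law_exists M.
  exists mu; first exact: calibrated_coherent law.
  exact: integral_obj_law.
move=> mu /coherent_calibrated[N calN law].
by rewrite (integral_obj_law al be p law) lee_fin; exact: maxM.
Qed.

End Maximum.

Section TwoPoints.
Context (R : realType) (p : R).
Hypothesis p01 : 0 <= p <= 1.

(** Weights of success and failure on the points 0 and 1. *)
Definition bern i : R := if i is 0%N then p else if i is 1%N then 1 - p else 0.
Definition success i : bool := i == 0%N.

Lemma bern_ge0 i : 0 <= bern i.
Proof. by case: i => [|[|i]] /=; move: p01; lra. Qed.

Lemma bern_sumE (f : nat -> R) : \sum_(i < 2) bern i * f i = p * f 0%N + (1 - p) * f 1%N.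
Proof. by rewrite !big_ord_recr big_ord0 /= add0r. Qed.

Lemma bern_sum : \sum_(i < 2) bern i = 1.
Proof. by rewrite !big_ord_recr big_ord0 /=; ring. Qed.

Definition ignorant : model R := finite_model 2 bern_ge0 success (fun=> p01) (fun=> p01).

Lemma success_unit i : 0 <= ((success i)%:R : R) <= 1.
Proof. by case: (success i); rewrite ?lexx ?ler01. Qed.

Definition omniscient : model R := finite_model 2 bern_ge0 success success_unit success_unit.

Lemma ignorant_calibrated : calibrated p ignorant.
Proof.
have -> : p = \sum_(i < 2) bern i * (success i)%:R.
  by rewrite (bern_sumE (fun i => (success i)%:R)) /=; ring.
by apply: finite_model_calibrated; rewrite ?bern_sum// => g;
  rewrite (bern_sumE (fun i => g p * ((success i)%:R - p))) /=; ring.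
Qed.

Lemma omniscient_calibrated : calibrated p omniscient.
Proof.
have e : p = \sum_(i < 2) bern i * (success i)%:R.
  by rewrite (bern_sumE (fun i => (success i)%:R)) /=; ring.
rewrite {1}e.
by apply: finite_model_calibrated; rewrite ?bern_sum// => g;
  rewrite (bern_sumE (fun i => g (success i)%:R * ((success i)%:R - (success i)%:R))) /=; ring.
Qed.

Lemma ignorant_value al be : value p ignorant al be = 0.
Proof.
rewrite /value /expect (Ex_finite bern_ge0 bern_sum); last exact: (bmf_objective ignorant).
by rewrite (bern_sumE (fun=> objective al be p (p, p))) /objective /=; ring.
Qed.

Lemma omniscient_value al be : value p omniscient al be = 4 * be * (p * (1 - p)).
Proof.
rewrite /value /expect (Ex_finite bern_ge0 bern_sum); last exact: (bmf_objective omniscient).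
rewrite (bern_sumE (fun i => objective al be p ((success i)%:R, (success i)%:R))).
by rewrite /objective /=; ring.
Qed.

Lemma omniscient_law (mu : plane_prob R) A : has_law omniscient mu -> measurable A ->
  mu A = (p * \1_A (1, 1) + (1 - p) * \1_A (0, 0))%:E.
Proof.
move=> law mA; rewrite (finite_model_law bern_sum law mA).
by rewrite (bern_sumE (fun i => \1_A ((success i)%:R, (success i)%:R))).
Qed.

End TwoPoints.

(** * Chains that reach the bound *)

Local Transparent rung.

Section Ladders.
Context (R : realType) (del x0 y0 : R).
Hypothesis del0 : del != 0.
Local Notation z := (rung del x0 y0).

Lemma support_ladder (mu : plane_prob R) (m k : nat) (r : nat -> R) :
  on_unit_square mu -> (forall i, (i < m)%N -> 0 < r i) ->
  (forall A, measurable A -> mu A = (\sum_(i < m) r i * \1_A (z (k + i)))%:E) ->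
  ladder_distribution m mu.
Proof.
move=> sq r0 muE; split=> //; exists [seq z i | i <- iota k m]; split.
- by rewrite size_map size_iota.
- exact: rungs_ladder.
- rewrite (finite_support (z := fun i => z (k + i)) r0 muE).
  by rewrite -{2}(addn0 k) iotaDl -map_comp.
Qed.

Lemma weights_ladder (m k : nat) (u : nat -> R) : (0 < m)%N ->
  (forall i, 0 <= u i) -> (forall i, (i < m)%N -> 0 < u i) ->
  (forall i, (i < m)%N -> 0 <= (z (k + i)).1 <= 1 /\ 0 <= (z (k + i)).2 <= 1) ->
  0 < \sum_(i < m) u i /\
  exists2 mu : plane_prob R, ladder_distribution m mu &
    forall A, mu A = ((\sum_(i < m) u i)^-1 * \sum_(i < m) u i * \1_A (z (k + i)))%:E.
Proof.
move=> m0 u0 up sq; set t := \sum_(i < m) u i.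
have t0 : 0 < t.
  rewrite /t (bigD1 (Ordinal m0))//= ltr_pwDl ?up//.
  by apply: sumr_ge0 => i _; exact: u0.
split => //; pose r i := u i / t.
have r0 i : 0 <= r i by rewrite divr_ge0 ?u0 ?ltW.
have r1 : \sum_(i < m) r i = 1 by rewrite -mulr_suml mulfV// gt_eqF.
pose mu : plane_prob R := finite_prob m r0 (fun i => z (k + i)).
have muE A : mu A = (\sum_(i < m) r i * \1_A (z (k + i)))%:E by exact: finite_probE.
exists mu.
  apply: (@support_ladder mu m k r) => //.
  - rewrite /on_unit_square muE -[RHS]/(1%:E); congr EFin.
    rewrite -[RHS]r1; apply: eq_bigr => i _.
    have [h1 h2] := sq i (ltn_ord i).
    have zin : (`[0, 1] `*` `[0, 1]) (z (k + i)) by split; rewrite /mkset in_itv;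
        [exact: h1|exact: h2].
    by rewrite indicE (mem_set zin) mulr1.
  - by move=> i im; apply: divr_gt0 => //; exact: up.
move=> A; rewrite muE; congr EFin; rewrite mulr_sumr; apply: eq_bigr => i _.
by rewrite /r mulrAC [LHS]mulrC.
Qed.

Lemma ladder_convex (n : nat) (mu : plane_prob R) :
  ladder_distribution n mu -> convex_comb_of_two_ladders n mu.
Proof.
move=> lad; exists 1, mu, mu; split => //; first by rewrite ler01 lexx.
by move=> A mA; rewrite subrr mul0e adde0 mul1e.
Qed.

(** Each inner point gives half of its mass to each part, the first point all of it to one part
and the last point all of it to the other. *)
Lemma split_ladder (mu : plane_prob R) (n : nat) (w : nat -> R) : (0 < n)%N ->
  (forall i, 0 <= w i) -> (forall i, (i < n.+1)%N -> 0 < w i) ->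
  \sum_(i < n.+1) w i = 1 ->
  (forall i, (i < n.+1)%N -> 0 <= (z i).1 <= 1 /\ 0 <= (z i).2 <= 1) ->
  (forall A, measurable A -> mu A = (\sum_(i < n.+1) w i * \1_A (z i))%:E) ->
  convex_comb_of_two_ladders n mu.
Proof.
move=> n0 w0 wp w1 sq muE.
(* The share of the first part in the mass of point i. *)
pose h (i : nat) : R := if i == 0%N then 1 else if i == n then 0 else 2^-1.
have h01 i : 0 <= h i <= 1.
  by rewrite /h; case: ifP => _; [|case: ifP => _]; apply/andP; split; lra.
have hn : h n = 0 by rewrite /h eqxx gtn_eqF.
pose u i := h i * w i; pose s i := (1 - h i.+1) * w i.+1.
have u0 i : 0 <= u i by rewrite mulr_ge0//; case/andP: (h01 i).
have s0 i : 0 <= s i by rewrite mulr_ge0// subr_ge0; case/andP: (h01 i.+1).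
have up i : (i < n)%N -> 0 < u i.
  move=> i_n; rewrite mulr_gt0//; last by rewrite wp// ltnW.
  by rewrite /h (ltn_eqF i_n); case: ifP => // _; lra.
have sp i : (i < n)%N -> 0 < s i.
  move=> i_n; rewrite mulr_gt0//; last by rewrite wp.
  by rewrite /h /=; case: ifP => // _; lra.
have splitE (f : nat -> R) : \sum_(i < n.+1) w i * f i =
    \sum_(i < n) u i * f (0 + i)%N + \sum_(i < n) s i * f (1 + i)%N.
  transitivity (\sum_(i < n.+1) u i * f i + \sum_(i < n.+1) (1 - h i) * w i * f i).
    by rewrite -big_split; apply: eq_bigr => i _; rewrite /u /=; ring.
  congr (_ + _); first by rewrite big_ord_recr /= /u hn !mul0r addr0.
  by rewrite big_ord_recl /= /h eqxx subrr !mul0r add0r.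
have [t0 [mu1 l1 e1]] := weights_ladder (k := 0) n0 u0 up (fun i i_n => sq i (ltnW i_n)).
have [v0 [mu2 l2 e2]] := weights_ladder (k := 1) n0 s0 sp (fun i i_n => sq i.+1 i_n).
have tv : \sum_(i < n) u i + \sum_(i < n) s i = 1.
  rewrite -w1; transitivity (\sum_(i < n.+1) w i * 1); last by apply: eq_bigr => i _;
      rewrite mulr1.
  by rewrite (splitE (fun=> 1)); congr (_ + _); apply: eq_bigr => i _; rewrite mulr1.
exists (\sum_(i < n) u i), mu1, mu2; split => //.
- by apply/andP; split; lra.
- move=> A mA; rewrite muE// e1 e2 (splitE (fun i => \1_A (z i))).
  rewrite (_ : 1 - _ = \sum_(i < n) s i); last by rewrite -tv; ring.
  by rewrite -!EFinM -EFinD !mulrA !mulfV ?mul1r// gt_eqF.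
Qed.

End Ladders.

Section Attained.
Context (R : realType) (al be p : R).
Hypotheses (al0 : 0 < al) (albe : 2 * be < al) (p01 : 0 <= p <= 1).
Let d := al - be.
Let lam := al / d.
Let b := (2 - lam) * p.
Let a := b + lam.

Let d0 : 0 < d. Proof. by rewrite /d; move: al0 albe; lra. Qed.
Let lam0 : 0 < lam. Proof. by rewrite divr_gt0. Qed.
Let lam2 : lam < 2. Proof. by rewrite /lam ltr_pdivrMr// /d; move: al0 albe; lra. Qed.

Definition bound : R := p * (1 - p) * (al ^+ 2 / d).

Lemma chain_attains (del x0 y0 : R) (c : bool) (m : nat) : (0 < m)%N ->
  vertex del x0 y0 0 = (label c 0)%:R -> vertex del x0 y0 m = (label c m.-1)%:R ->
  (forall k, (0 < k < m)%N -> 0 < vertex del x0 y0 k < 1) ->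
  (forall i, (rung del x0 y0 i).1 + (rung del x0 y0 i).2 = b + lam * (label c i)%:R) ->
  exists (mu : plane_prob R) (w : nat -> R),
    [/\ coherent p mu, integral_obj al be p mu = bound%:E,
     forall i, 0 <= w i, (forall i, (i < m)%N -> 0 < w i) /\ \sum_(i < m) w i = 1 &
     (forall i, (i < m)%N -> 0 <= (rung del x0 y0 i).1 <= 1 /\ 0 <= (rung del x0 y0 i).2 <= 1) /\
     (forall A, measurable A -> mu A = (\sum_(i < m) w i * \1_A (rung del x0 y0 i))%:E)].
Proof.
move=> m0 v0 vm vi sumE.
have d_neq0 : al - be != 0 by rewrite gt_eqF.
have lam_neq2 : al / (al - be) != 2 by rewrite lt_eqF.
pose M := chain_model c m0 vi.
have cal : calibrated p M.
  have := chain_model_calibrated m0 v0 vm vi.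
  by rewrite (chain_mean m0 v0 vm vi lam_neq2 sumE).
have [mu law] := has_law_exists M.
exists mu, (chain_weight del x0 y0 c m); split.
- exact: calibrated_coherent law.
- by rewrite (integral_obj_law al be p law) [expect _](chain_value m0 v0 vm vi d_neq0 lam_neq2
    sumE).
- by move=> i; exact: (chain_weight_ge0 c m0 vi).
- by split; [exact: (chain_weight_gt0 c m0 vi)|exact: (chain_weight_sum c m0 vi)].
- split; first exact: (rung_unit v0 vm vi).
  by move=> A mA; exact: (chain_law v0 vm law mA).
Qed.

Lemma odd_half_cases i : i = (i./2).*2 /\ odd i = false \/ i = (i./2).*2.+1 /\ odd i = true.
Proof.
have := odd_double_half i; case: (odd i) => /= e; [right|left]; split => //.
Qed.

Lemma rung_sum (del x0 y0 : R) i :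
  (rung del x0 y0 i).1 + (rung del x0 y0 i).2 = x0 + y0 - del * (odd i)%:R.
Proof. by rewrite /rung /= uphalf_half natrD; ring. Qed.

Lemma lam_le (j k : nat) : (j <= k)%N -> lam * j%:R <= lam * k%:R.
Proof. by move=> jk; rewrite ler_wpM2l ?ler_nat// ltW. Qed.

Definition attained N := exists mu : plane_prob R,
  [/\ coherent p mu, integral_obj al be p mu = bound%:E & ladder_distribution (2 * N - 1) mu].

(** The walk starts at the value 1 of the first expert and ends at the value 1 of the second. *)
Lemma attained_high N : a = 2 - (N%:R - 1) * lam -> 1 < a -> attained N.
Proof.
case: N => [|k] ea a1.
  exfalso; have : p <= 1 by case/andP: p01.
  move: ea a1; rewrite /a /b; move: lam0 lam2 => l0 l2 ea a1 p1.
  have : (2 - lam) * (1 - p) >= 0 by rewrite mulr_ge0; lra.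
  by lra.
rewrite -(natr1 k) addrK in ea.
have [] := @chain_attains lam 1 (a - 1) true k.*2.+1 isT.
- by rewrite /vertex /= mulr0 subr0.
- by rewrite /vertex /label /= odd_double uphalf_double /= ea; ring.
- move=> i /andP[i0 im]; rewrite /vertex.
  have [[e o]|[e o]] := odd_half_cases i; rewrite o.
    have j1 : (1 <= i./2)%N by move: i0; rewrite e double_gt0 doubleK.
    have j2 : (i./2 <= k)%N by move: im; rewrite {1}e ltnS leq_double.
    have := lam_le j1; have := lam_le j2; rewrite mulr1; move: lam0.
    by move=> ? ? ?; apply/andP; split; lra.
  have j2 : (i./2.+1 <= k)%N by move: im; rewrite {1}e ltnS ltn_double.
  have := lam_le j2; have := lam_le (leq0n i./2); rewrite mulr0 -(natr1 i./2) mulrDr mulr1;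
      move: lam0.
  by move=> ? ? ?; apply/andP; split; lra.
- by move=> i; rewrite rung_sum /label /=; case: (odd i) => /=; rewrite /a; ring.
move=> mu [w [coh val w0 [wp w1] [sq muE]]]; exists mu; split => //.
rewrite mul2n doubleS subn1 /=.
apply: (@support_ladder _ lam 1 (a - 1) _ mu k.*2.+1 0 w) => //; first by rewrite gt_eqF.
by case: coh.
Qed.

(** The walk starts at the value 0 of the first expert and ends at the value 0 of the second. *)
Lemma attained_low N : b = (N%:R - 1) * lam -> b < 1 -> attained N.
Proof.
case: N => [|k] eb b1.
  exfalso; have : 0 <= p by case/andP: p01.
  move=> p0; have : 0 <= b by rewrite mulr_ge0//; move: lam2; lra.
  by rewrite eb; move: lam0; lra.
rewrite -(natr1 k) addrK in eb.
have [] := @chain_attains (- lam) 0 b false k.*2.+1 isT.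
- by rewrite /vertex /= mulr0 subr0.
- by rewrite /vertex /label /= odd_double uphalf_double /= eb; ring.
- move=> i /andP[i0 im]; rewrite /vertex.
  have [[e o]|[e o]] := odd_half_cases i; rewrite o.
    have j1 : (1 <= i./2)%N by move: i0; rewrite e double_gt0 doubleK.
    have j2 : (i./2 <= k)%N by move: im; rewrite {1}e ltnS leq_double.
    have := lam_le j1; have := lam_le j2; rewrite mulr1; move: lam0.
    by move=> ? ? ?; apply/andP; split; lra.
  have j2 : (i./2.+1 <= k)%N by move: im; rewrite {1}e ltnS ltn_double.
  have := lam_le j2; have := lam_le (leq0n i./2); rewrite mulr0 -(natr1 i./2) mulrDr mulr1;
      move: lam0.
  by move=> ? ? ?; apply/andP; split; lra.
- by move=> i; rewrite rung_sum /label /=; case: (odd i) => /=; ring.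
move=> mu [w [coh val w0 [wp w1] [sq muE]]]; exists mu; split => //.
rewrite mul2n doubleS subn1 /=.
apply: (@support_ladder _ (- lam) 0 b _ mu k.*2.+1 0 w) => //; first by rewrite oppr_eq0 gt_eqF.
by case: coh.
Qed.

(** The walk goes from the value 1 to the value 0 of the first expert; its number of points is
even. *)
Lemma attained_middle N : 1 = N%:R * lam -> 1 < a -> b < 1 ->
  exists mu : plane_prob R, [/\ coherent p mu, integral_obj al be p mu = bound%:E &
    convex_comb_of_two_ladders (2 * N - 1) mu].
Proof.
case: N => [|k] e1 a1 b1; first by move: e1; rewrite mul0r => /eqP; rewrite oner_eq0.
rewrite -(natr1 k) mulrDl mul1r in e1.
have [] := @chain_attains lam 1 (a - 1) true k.+1.*2 isT.
- by rewrite /vertex /= mulr0 subr0.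
- by rewrite /vertex odd_double doubleK /label doubleS /= odd_double /= -(natr1 k); lra.
- move=> i /andP[i0 im]; rewrite /vertex.
  have [[e o]|[e o]] := odd_half_cases i; rewrite o.
    have j1 : (1 <= i./2)%N by move: i0; rewrite e double_gt0 doubleK.
    have j2 : (i./2 <= k)%N by move: im; rewrite {1}e ltn_double ltnS.
    have := lam_le j1; have := lam_le j2; rewrite mulr1; move: lam0.
    by move=> ? ? ?; apply/andP; split; lra.
  have j2 : (i./2 <= k)%N by move: im; rewrite {1}e doubleS ltnS ltnS leq_double.
  have := lam_le j2; have := lam_le (leq0n i./2); rewrite mulr0; move: lam0; rewrite /a in a1 *.
  by move=> ? ? ?; apply/andP; split; lra.
- by move=> i; rewrite rung_sum /label /=; case: (odd i) => /=; rewrite /a; ring.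
move=> mu [w [coh val w0 [wp w1] [sq muE]]]; exists mu; split => //.
rewrite mul2n doubleS subn1 /=.
apply: (@split_ladder _ lam 1 (a - 1) _ mu k.*2.+1 w) => //; by rewrite gt_eqF.
Qed.

End Attained.

(** * The equality cases and the main theorem *)

Section Conditions.
Context (R : realType) (al be p : R).
Hypotheses (al0 : 0 < al) (albe : 2 * be <= al) (p01 : 0 <= p <= 1).
Let lam := al / (al - be).

Let d0 : 0 < al - be. Proof. by move: al0 albe; lra. Qed.
Let lam0 : 0 < lam. Proof. by rewrite divr_gt0. Qed.
Let alE : al = lam * (al - be). Proof. by rewrite /lam divfK// gt_eqF. Qed.

Let divE (s t : R) : s * (al - be) / al = t <-> s = t * lam.
Proof.
split => [h|->]; last by rewrite -(mulrA t) -alE mulfK// gt_eqF.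
by apply: (mulIf (negbT (gt_eqF d0))); rewrite -(mulrA t) -alE -h divfK// gt_eqF.
Qed.

Lemma condition1P N : condition1 al be p N <->
  1 = N%:R * lam /\ (2 - lam) * p <= 1 <= (2 - lam) * p + lam.
Proof.
rewrite /condition1 -/lam -[X in X / al]mul1r.
by split => -[h1 h2]; split => //; exact/divE.
Qed.

Lemma condition2P N : condition2 al be p N <->
  (2 - lam) * p + lam = 2 - (N%:R - 1) * lam /\ 1 < (2 - lam) * p + lam.
Proof.
rewrite /condition2 -/lam.
have -> : 2 * (al - be) - (al - 2 * be) * p = (2 - (2 - lam) * p) * (al - be).
  rewrite [RHS](_ : _ = 2 * (al - be) - 2 * (al - be) * p + lam * (al - be) * p).
    by rewrite -alE; ring.
  by ring.
split => -[h1 h2]; split => //; first by move/divE: h1; lra.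
by apply/divE; lra.
Qed.

Lemma condition3P N : condition3 al be p N <->
  (2 - lam) * p = (N%:R - 1) * lam /\ (2 - lam) * p < 1.
Proof.
rewrite /condition3 -/lam.
have -> : 2 * (al - be) - (al - 2 * be) * (1 - p) = (2 - (2 - lam) * (1 - p)) * (al - be).
  rewrite [RHS](_ : _ = 2 * (al - be) - 2 * (al - be) * (1 - p) + lam * (al - be) * (1 - p)).
    by rewrite -alE; ring.
  by ring.
split => -[h1 h2]; split => //; first by move/divE: h1; lra.
by apply/divE; lra.
Qed.

Lemma value_le_bound (M : model R) : calibrated p M -> value p M al be <= bound al be p.
Proof.
move=> cal; rewrite /bound -(value_deficit cal (al := al) (be := be)) ?gt_eqF//.
rewrite lerDl mulr_ge0 ?(ltW d0)//; apply: Ex_ge0 => w; exact: sqr_ge0.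
Qed.

(** When the middle case of [two_ended_chain] is met with [b = 1], or its last case with [a =
1], the relation is an instance of condition 1. *)
Lemma equality_condition (M : model R) : calibrated p M -> value p M al be = bound al be p ->
  exists N, [\/ condition1 al be p N, condition2 al be p N | condition3 al be p N].
Proof.
move=> cal eqv; have d_neq0 : al - be != 0 by rewrite gt_eqF.
have := value_deficit cal d_neq0; rewrite eqv => def.
have def0 : expect (fun w => (expert1 M w + expert2 M w - 2 * p - lam * (outcomeR M w - p)) ^+
    2) = 0.
  by apply: (mulfI d_neq0); rewrite mulr0; move: def; rewrite /bound -/lam; lra.
have sumE : {ae mprob M, forall w, expert1 M w + expert2 M w = (2 - lam) * p + lam * outcomeR
    M w}.
  have bf : bmf (fun w => (expert1 M w + expert2 M w - 2 * p - lam * (outcomeR M w - p)) ^+ 2).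
    have b1 := bmf_expert1 M; have b2 := bmf_expert2 M; have bc := bmf_outcomeR M.
    by bmft.
  apply: filterS (Ex_eq0_ae bf (fun w => sqr_ge0 _) def0) => w /eqP.
  by rewrite sqrf_eq0 => /eqP; lra.
have [n [[e1 h1 h2]|[e1 h1]|[e1 h1]]] := two_ended_chain cal lam0 sumE.
- by exists n; apply: Or31; apply/condition1P; split => //; apply/andP.
- have [h|h] := ltP ((2 - lam) * p) 1.
    by exists n.+1; apply: Or33; apply/condition3P; rewrite -(natr1 n) addrK.
  by exists n; apply: Or31; apply/condition1P; move: lam0; split; [lra|apply/andP; split; lra].
- have [h|h] := ltP 1 ((2 - lam) * p + lam).
    by exists n.+1; apply: Or32; apply/condition2P; rewrite -(natr1 n) addrK.
  by exists n; apply: Or31; apply/condition1P; move: lam0; split; [lra|apply/andP; split; lra].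
Qed.

(** Here [lambda = 2], both experts know the outcome, and no chain joins 0 to 1. *)
Definition degenerate : Prop := al = 2 * be /\ 0 < p < 1.

(** Condition 1 with [a = 1] or [b = 1] is also an instance of condition 3 or 2 with the same
[N], which is why only the strict case needs a convex combination. *)
Lemma condition_attained N :
  [\/ condition1 al be p N, condition2 al be p N | condition3 al be p N] ->
  exists mu : plane_prob R,
    [/\ coherent p mu, integral_obj al be p mu = (bound al be p)%:E &
      ladder_distribution (2 * N - 1) mu \/
      (condition1 al be p N \/ degenerate) /\ convex_comb_of_two_ladders (2 * N - 1) mu].
Proof.
move=> cond; case: (ltrgtP (2 * be) al) => [lt||e]; [|by move: albe; lra|].
  have high := @attained_high R al be p al0 lt p01 N.
  have low := @attained_low R al be p al0 lt p01 N.
  rewrite -/lam in high low.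
  have ladder_case : attained al be p N -> exists mu : plane_prob R,
      [/\ coherent p mu, integral_obj al be p mu = (bound al be p)%:E &
      ladder_distribution (2 * N - 1) mu \/
      (condition1 al be p N \/ degenerate) /\ convex_comb_of_two_ladders (2 * N - 1) mu].
    by move=> [mu [h1 h2 h3]]; exists mu; split => //; left.
  case: cond => [c1|/condition2P[h1 h2]|/condition3P[h1 h2]];
      [|exact/ladder_case/high|exact/ladder_case/low].
  have /condition1P[e1 /andP[h1 h2]] := c1.
  have [a1|a1] := ltP 1 ((2 - lam) * p + lam); last by apply/ladder_case/low; move: lam0; lra.
  have [b1|b1] := ltP ((2 - lam) * p) 1; last by apply/ladder_case/high; move: lam0; lra.
  have [mu [coh val conv]] := attained_middle al0 lt e1 a1 b1.
  by exists mu; split => //; right; split => //; left.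
(* From here on [al = 2 be]: the sum relation forces both experts to know the outcome. *)
have l2 : lam = 2.
  by apply: (@mulIf _ (al - be)); rewrite ?gt_eqF// -alE -e; ring.
have N1 : N = 1%N.
  apply/eqP; rewrite -(eqr_nat R); apply/eqP.
  case: cond => [/condition1P[h _]|/condition2P[h _]|/condition3P[h _]].
  - rewrite l2 in h; exfalso; have : (2 * N)%N = 1%N by apply/eqP; rewrite -(eqr_nat R) natrM;
      apply/eqP; lra.
    by lia.
  - by rewrite l2 in h; lra.
  - by rewrite l2 in h; lra.
rewrite N1 /=.
pose M := omniscient p01.
have cal : calibrated p M := omniscient_calibrated p01.
have [mu law] := has_law_exists M.
have coh : coherent p mu := calibrated_coherent cal law.
have muE A : measurable A -> mu A = (p * \1_A (1, 1) + (1 - p) * \1_A (0, 0))%:E.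
  exact: omniscient_law.
have n1 : (1 : R) != 0 by exact: oner_neq0.
have sq := law_unit_square law.
exists mu; split => //.
  rewrite (integral_obj_law al be p law) [expect _]omniscient_value; congr EFin.
  have be0 : be != 0 by apply/eqP => b0; move: al0; rewrite -e b0; lra.
  have eb : al - be = be by rewrite -e; ring.
  by rewrite /bound eb -e; field.
have [p1|p1] := ltP p 1; last first.
  left; apply: (@support_ladder _ 1 1 1 n1 mu 1 0 (fun=> 1)) => // A mA.
  have -> : mu A = (p * \1_A (1, 1) + (1 - p) * \1_A (0, 0))%:E by exact: muE.
  rewrite big_ord1 /rung /= !mulr0 subr0 addr0; congr EFin.
  have -> : p = 1 by move: p01; lra.
  by rewrite subrr mul0r addr0.
have [p0|p0] := ltP 0 p; last first.
  left; apply: (@support_ladder _ 1 0 0 n1 mu 1 0 (fun=> 1)) => // A mA.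
  have -> : mu A = (p * \1_A (1, 1) + (1 - p) * \1_A (0, 0))%:E by exact: muE.
  rewrite big_ord1 /rung /= !mulr0 subr0 addr0; congr EFin.
  have -> : p = 0 by move: p01; lra.
  by rewrite subr0 mul0r add0r.
right; split; first by right; rewrite /degenerate p0 p1.
have lad (t : R) : 0 <= t <= 1 -> exists2 nu : plane_prob R, ladder_distribution 1 nu &
    forall A, nu A = (\1_A (t, t))%:E.
  move=> t01.
  have [|//|//|_ [nu lad nuE]] := @weights_ladder R 1 t t n1 1 0 (fun=> 1) isT.
  - by move=> i; exact: ler01.
  - by move=> [|i] //= _; rewrite /rung /= mulr0 subr0 addr0.
  exists nu => // A; rewrite nuE !big_ord1 /rung /= mulr0 subr0 addr0.
  by rewrite invr1 !mul1r.
have [|mu1 l1 e1] := lad 1; first by rewrite ler01 lexx.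
have [|mu0 l0 e0] := lad 0; first by rewrite ler01 lexx.
exists p, mu1, mu0; split => // A mA.
by rewrite muE// e1 e0 -!EFinM -EFinD.
Qed.

End Conditions.

Theorem theorem1p1 (R : realType) (alpha beta p : R) (hp : 0 <= p <= 1) :
  (alpha < 0 \/ alpha < 2 * beta ->
     is_max_integral alpha beta p
       (Num.max 0 (Num.max (4 * beta) (alpha + beta)) * (p * (1 - p)))) /\
  (Num.max 0 (2 * beta) <= alpha ->
     exists M : R,
       [/\ is_max_integral alpha beta p M,
           M <= p * (1 - p) * (alpha ^+ 2 / (alpha - beta)),
           (0 < alpha ->
             (M = p * (1 - p) * (alpha ^+ 2 / (alpha - beta)) <->
              exists N : nat, [\/ condition1 alpha beta p N,
                                  condition2 alpha beta p N |
                                  condition3 alpha beta p N])) &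
           (0 < alpha ->
            M = p * (1 - p) * (alpha ^+ 2 / (alpha - beta)) ->
            forall N : nat, [\/ condition1 alpha beta p N,
                                condition2 alpha beta p N |
                                condition3 alpha beta p N] ->
              (~ condition1 alpha beta p N ->
               ~ (alpha = 2 * beta /\ 0 < p < 1) ->
               exists2 mu, optimal alpha beta p mu &
                           ladder_distribution (2 * N - 1) mu) /\
              (condition1 alpha beta p N \/ alpha = 2 * beta /\ 0 < p < 1 ->
               exists2 mu, optimal alpha beta p mu &
                           convex_comb_of_two_ladders (2 * N - 1) mu))]).
Proof.
split=> [easy|].
  have p1p : 0 <= p * (1 - p) by move: hp => /andP[? ?]; rewrite mulr_ge0// subr_ge0.
  have val N := @value_le_easy R p N.
  have [be0|be0] := leP 0 beta.
    have maxE : Num.max 0 (Num.max (4 * beta) (alpha + beta)) = 4 * beta.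
      by rewrite (@max_l _ _ (4 * beta)) ?max_r//; case: easy => h; lra.
    rewrite maxE -(omniscient_value hp alpha).
    apply: model_is_max (omniscient_calibrated hp) _ => N calN.
    by rewrite omniscient_value -maxE; exact: val.
  have maxE : Num.max 0 (Num.max (4 * beta) (alpha + beta)) = 0.
    by rewrite max_l// ge_max; apply/andP; split; case: easy => h; lra.
  rewrite maxE mul0r -(ignorant_value hp alpha beta).
  apply: model_is_max (ignorant_calibrated hp) _ => N calN.
  by rewrite ignorant_value -[leRHS](mul0r (p * (1 - p))) -maxE; exact: val.
rewrite ge_max => /andP[al_ge0 albe].
have [al0|al_le0] := ltP 0 alpha; last first.
  have alE : alpha = 0 by lra.
  exists 0; split; last 3 first.
  - by rewrite alE expr0n /= mul0r mulr0.
  - by [].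
  - by [].
  rewrite -(ignorant_value hp alpha beta).
  apply: model_is_max (ignorant_calibrated hp) _ => N calN.
  rewrite ignorant_value -[leRHS](mul0r (p * (1 - p))).
  apply: (value_le calN (k := 0)) => w; rewrite /objective /= alE !mul0r add0r addr0.
  by rewrite mulr_le0_ge0 ?sqr_ge0//; lra.
have [M calM maxM] := @maximal_model R p alpha beta hp (ex_intro _ _ (ignorant_calibrated hp)).
have isM := model_is_max calM maxM.
exists (value p M alpha beta).
have reached N : [\/ condition1 alpha beta p N, condition2 alpha beta p N |
    condition3 alpha beta p N] -> value p M alpha beta = bound alpha beta p.
  move=> /(condition_attained al0 albe hp)[mu [coh val _]].
  apply/eqP; rewrite eq_le (value_le_bound al0 albe calM) /=.
  by rewrite -lee_fin -val; apply: isM.2.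
split => //.
- exact: value_le_bound.
- move=> _; split; first exact: equality_condition.
  by move=> [N cond]; exact: reached cond.
- move=> _ eqM N cond.
  have [mu [coh val lad]] := condition_attained al0 albe hp cond.
  have opt : optimal alpha beta p mu.
    by split=> // nu cohnu; rewrite val -[bound _ _ _]eqM; exact: isM.2.
  split=> [n1 nd|sp]; exists mu => //.
    by case: lad => // -[[]].
  by case: lad => [/ladder_convex|[]].
Qed.
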